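(* Let $U = U_1 \sqcup U_2$ and $V = V_1 \sqcup V_2$ be disjoint sets of vertices with $|U| = n$, $|U_i| = n_i$, $|V| = m$, $|V_i| = m_i$ and $1 \leq n_i, m_i$ for $i = 1, 2$, where $U=\{x_1,\ldots,x_n\}$, $U_1=\{x_1,\ldots,x_{n_1}\}$, $V=\{y_1,\ldots,y_m\}$, $V_1=\{y_1,\ldots,y_{m_1}\}$. Let $G$ be the bipartite graph $K_{U_1, V}\cup K_{U_2, V_2}$. Let $K$ be a field, let $R = K[x_1, \ldots, x_n, y_1, \ldots, y_m]$ with the standard grading, and let $J_G \subset R$ denote the cover ideal of $G$. Let $s\ge 1$. Then the minimal free resolution of $R/J_G^s$ is of the form \[ 0 \longrightarrow R^{\binom{s}{2}} \longrightarrow R^{2\binom{s+1}{2}} \longrightarrow R^{\binom{s+2}{2}} \longrightarrow R \longrightarrow 0. \] Moreover, $\operatorname{reg} J_G^s$ is the maximum of all the following numbers, where $i,j$ range over the integers in the indicated ranges: \[ \operatorname{reg} J_G^s = \max \left\{ \begin{array}{ll} (s-j)n_1 + (s-i)n_2 + jm_1 + im_2 & \text{ for } 0 \leq j \leq i \leq s,\\ (s-j)n_1 + (s-i)n_2 + (j+1)m_1 + im_2 - 1& \text{ for } 0 \leq j < i \leq s,\\ (s-j)n_1 + (s-i+1)n_2 + jm_1 + im_2 - 1& \text{ for } 0 \leq j < i \leq s,\\ (s-j)n_1 + (s-i)n_2 + (j+1)m_1 + (i+1)m_2 - 2& \text{ for } 0 \leq j < i < s \end{array} \right\}. \]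
   Context: For disjoint vertex sets $A,B$, $K_{A,B}$ denotes the complete bipartite graph on $A\sqcup B$ (edges: all $\{a,b\}$ with $a\in A$, $b\in B$). For graphs $G,H$, $G\cup H$ is the graph with vertex set $V(G)\cup V(H)$ and edge set $E(G)\cup E(H)$. A vertex cover of $G$ is a set $w$ of vertices meeting every edge. The cover ideal $J_G$ is the ideal generated by the squarefree monomials $\prod_{v\in w}v$ with $w$ a vertex cover of $G$ (vertices identified with variables); equivalently $J_G=\bigcap_{\{u,v\}\in E(G)}(u,v)$. For a finitely generated graded $R$-module $M$, $\operatorname{reg}(M)=\max\{j-i : \operatorname{Tor}_i^R(M,K)_j\neq 0\}$ is the Castelnuovo-Mumford regularity. Conventions: $\binom{a}{b}=0$ if $0\le a<b$, and an empty range contributes nothing to the maximum. *)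

(* Defs.v *)
From HB Require Import structures.
From mathcomp Require Import all_boot all_order all_algebra.
From mathcomp Require Import mpoly.

Set Implicit Arguments.
Unset Strict Implicit.
Unset Printing Implicit Defensive.

Import Order.TTheory GRing.Theory Num.Theory.

Local Open Scope ring_scope.

(** * Finite simple graphs *)

Section Graphs.

Variable T : finType.

Record graph := Graph {
  verts : {set T};
  edges : {set {set T}};
  edgesP : [forall e in edges, (e \subset verts) && (#|e| == 2)]
}.

Definition complete_bipartite_edges (A B : {set T}) : {set {set T}} :=
  [set [set a; b] | a in A, b in B & a != b].

Lemma complete_bipartite_edgesP (A B : {set T}) :
  [forall e in complete_bipartite_edges A B,
     (e \subset A :|: B) && (#|e| == 2)].
Proof.
apply/forall_inP => e /imset2P[a b aA]; rewrite inE => /andP[bB ab] ->.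
by rewrite cards2 ab andbT subUset !sub1set !inE aA bB orbT.
Qed.

(* Meant for disjoint A and B, for which the test a != b above is vacuous. *)
Definition complete_bipartite (A B : {set T}) : graph :=
  Graph (complete_bipartite_edgesP A B).

Lemma graph_union_edgesP (G H : graph) :
  [forall e in edges G :|: edges H,
     (e \subset verts G :|: verts H) && (#|e| == 2)].
Proof.
apply/forall_inP => e; rewrite inE => /orP[] He.
- have /andP[eV ->] := forall_inP (edgesP G) e He.
  by rewrite (subset_trans eV (subsetUl _ _)).
- have /andP[eV ->] := forall_inP (edgesP H) e He.
  by rewrite (subset_trans eV (subsetUr _ _)).
Qed.

Definition graph_union (G H : graph) : graph := Graph (graph_union_edgesP G H).

Definition vertex_cover (G : graph) (w : {set T}) : bool :=
  (w \subset verts G) && [forall e in edges G, w :&: e != set0].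

End Graphs.

(** * Ideals of polynomial rings, as predicates *)

Section Ideals.

Variables (K : fieldType) (N : nat).
Local Notation R := {mpoly K[N]}.

Definition ideal_gen (S : R -> Prop) (p : R) : Prop :=
  exists (k : nat) (c g : 'I_k -> R),
    (forall t, S (g t)) /\ p = \sum_(t < k) c t * g t.

Definition ideal_pow (I : R -> Prop) (s : nat) : R -> Prop :=
  ideal_gen (fun p => exists f : 'I_s -> R,
    (forall t, I (f t)) /\ p = \prod_(t < s) f t).

Definition unit_ideal (p : R) : Prop := True.

Definition zero_ideal (p : R) : Prop := p = 0.

Definition cover_ideal (G : graph 'I_N) : R -> Prop :=
  ideal_gen (fun p => exists w : {set 'I_N},
    vertex_cover G w /\ p = \prod_(v in w) 'X_v).

End Ideals.

(** * Graded free resolutions, Tor and regularity *)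

(* [shift F i k] is the degree of the k-th basis element of F_i, so that
   F_i is the direct sum of the R(- shift F i k).  Maps act on row vectors on
   the right, and [diff F i] is the matrix of F_(i+1) -> F_i. *)
Record free_complex (K : fieldType) (N : nat) := FreeComplex {
  rank : nat -> nat;
  shift : forall i, 'I_(rank i) -> int;
  diff : forall i, 'M[{mpoly K[N]}]_(rank i.+1, rank i)
}.

Section Resolutions.

Variables (K : fieldType) (N : nat).
Local Notation R := {mpoly K[N]}.
Implicit Types (A B : R -> Prop) (F : free_complex K N).

(* Homogeneous of degree d in the standard grading; 0 has every degree. *)
Definition homog_of_degree (d : int) (p : R) : Prop :=
  forall m : 'X_{1..N}, m \in msupp p -> (mdeg m)%:Z = d.

(* F is a graded free resolution of the graded module A / B, for homogeneous
   ideals B contained in A.  The k-th row of eps is a homogeneous representative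
   in A of the image in A / B of the k-th basis element of F_0. *)
Definition graded_resolution A B F : Prop :=
  exists eps : 'cV[R]_(rank F 0),
  [/\ (forall k, homog_of_degree (shift (i := 0) k) (eps k 0)),
      (forall i k l,
         homog_of_degree (shift (i := i.+1) k - shift l) (diff F i k l)),
      (forall p, A p <->
         exists (u : 'rV[R]_(rank F 0)) (b : R),
           B b /\ p = (u *m eps) 0 0 + b),
      (forall u : 'rV[R]_(rank F 0),
         B ((u *m eps) 0 0) <-> exists w, u = w *m diff F 0) &
      (forall i (u : 'rV[R]_(rank F i.+1)),
         u *m diff F i = 0 <-> exists w, u = w *m diff F i.+1)].

(* Every differential has its entries in the ideal generated by the variables. *)
Definition minimal F : Prop :=
  forall i k l, mcoeff 0%MM (diff F i k l) = 0.

(* The matrix of the differential of F (x)_R K, where K is the quotient of R by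
   the ideal generated by the variables. *)
Definition diffK F i : 'M[K]_(rank F i.+1, rank F i) :=
  map_mx (mcoeff 0%MM) (diff F i).

Definition cycleK F i : 'rV[K]_(rank F i) -> Prop :=
  match i with
  | 0 => fun=> True
  | i'.+1 => fun v => v *m diffK F i' = 0
  end.

(* H_i(F (x)_R K)_j <> 0. *)
Definition homologyK_neq0 F i (j : int) : Prop :=
  exists v : 'rV[K]_(rank F i),
  [/\ (forall k, v 0 k != 0 -> shift k = j),
      cycleK v &
      ~ exists w, v = w *m diffK F i].

(* Tor_i^R(A / B, K)_j <> 0.  As Tor does not depend on the resolution, any
   graded free resolution of A / B may be used. *)
Definition tor_neq0 A B i (j : int) : Prop :=
  exists2 F, graded_resolution A B F & homologyK_neq0 F i j.

Definition is_max (P : int -> Prop) (r : int) : Prop :=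
  P r /\ forall r', P r' -> r' <= r.

(* r = reg(A / B). *)
Definition is_regularity A B (r : int) : Prop :=
  is_max (fun t => exists i j, tor_neq0 A B i j /\ t = j - i%:Z) r.

End Resolutions.

(* Main.v *)
(** Write a, b, c, d for the products of the variables in U1, U2, V1, V2. The
    minimal vertex covers give J = (ab, ad, cd), so J^s is generated by the
    monomials a^(s-j) c^j b^(s-i) d^i with j <= i <= s.  Placing them at the
    points (i, j) of a grid, the unit edges and unit squares of this staircase
    carry a cellular complex, whose ranks and degrees are those of the theorem.

    Its exactness only needs that a, b, c, d are monomials in disjoint sets of
    variables: for coprime a and c the syzygies of the powers a^(i-j) c^j are
    generated by the obvious ones, and dividing out d commutes with
    multiplication by a and c.  Applying this row by row gives exactness at the
    vertices and at the edges.  As the entries of the differentials lie in the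
    maximal ideal, the comparison theorem for free resolutions identifies the
    degrees of Tor with the degrees of the cells. *)

From HB Require Import structures.
Require Import Defs.
From mathcomp Require Import all_boot all_order all_algebra.
From mathcomp Require Import mpoly.
From mathcomp Require Import ring zify.

Set Implicit Arguments.
Unset Strict Implicit.
Unset Printing Implicit Defensive.

Import Order.TTheory GRing.Theory Num.Theory.

Local Open Scope ring_scope.

(** * Monomials and homogeneous components *)

Section Monomials.

Variables (K : fieldType) (N : nat).
Local Notation R := {mpoly K[N]}.
Implicit Types (p q : R) (w : {set 'I_N}).

(** Common to division by a monomial and to homogeneous components, which both select monomials of
    [p] by [P] and move them by [f]. Uniqueness of the preimage is asked only under [P], since
    truncated subtraction of exponents is not injective in general. *)
Lemma mcoeff_sumX (P : pred 'X_{1..N}) (f : 'X_{1..N} -> 'X_{1..N}) p k l :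
    f l = k -> (forall x, P x -> f x = k -> x = l) ->
  (\sum_(m <- msupp p | P m) p@_m *: 'X_[f m])@_k = if P l then p@_l else 0.
Proof.
move=> flk f_inj; rewrite raddf_sum /= big_mkcond /=.
have [l_p|l_p] := boolP (l \in msupp p).
  rewrite (bigD1_seq l) //= mcoeffZ mcoeffX flk eqxx mulr1.
  rewrite big1 ?addr0 // => x xl; case: ifP => // Px.
  by rewrite mcoeffZ mcoeffX; case: eqP => [/(f_inj _ Px) /eqP|];
    rewrite ?(negPf xl) ?mulr0.
rewrite big_seq big1 => [|x x_p]; first by rewrite memN_msupp_eq0 ?if_same.
case: ifP => // Px; rewrite mcoeffZ mcoeffX; case: eqP; rewrite ?mulr0 // => fx.
by rewrite (f_inj _ Px fx) (negPf l_p) in x_p.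
Qed.

Lemma mcoeffMX_if p k m :
  (p * 'X_[k])@_m = if (k <= m)%MM then p@_(m - k)%MM else 0.
Proof.
case: ifP => km; first by rewrite -{1}(submK km) addmC mcoeffMX.
rewrite mcoeffM big1 // => -[x y] /= /eqP mxy.
rewrite mcoeffX; case: eqP => [yk|]; last by rewrite mulr0.
by rewrite mxy -yk lem_addl in km.
Qed.

(** Division by X^k that discards the terms not divisible by X^k. It is thus total and additive, and
    applies to sums term by term. *)
Definition mdivX k p : R :=
  \sum_(m <- msupp p | (k <= m)%MM) p@_m *: 'X_[(m - k)%MM].

Lemma mcoeff_mdivX k p m : (mdivX k p)@_m = p@_(m + k)%MM.
Proof.
rewrite (@mcoeff_sumX _ _ _ m (m + k)%MM) ?lem_addl ?addmK //.
by move=> x kx <-; rewrite submK.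
Qed.

Lemma mdivX_zmod_morphism_subproof k : zmod_morphism (mdivX k).
Proof.
by move=> p q; apply/mpolyP => m; rewrite mcoeffB !mcoeff_mdivX mcoeffB.
Qed.

HB.instance Definition _ k :=
  GRing.isZmodMorphism.Build R R (mdivX k) (mdivX_zmod_morphism_subproof k).

Lemma mdivXMX k p : mdivX k ('X_[k] * p) = p.
Proof. by apply/mpolyP => m; rewrite mcoeff_mdivX mulrC addmC mcoeffMX. Qed.

(** When no variable occurs in both monomials, X^l divides X^(m + k) exactly when it divides X^m. *)
Lemma mdivX_disjoint (k l : 'X_{1..N}) p : (forall v, k v = 0%N \/ l v = 0%N) ->
  mdivX k ('X_[l] * p) = 'X_[l] * mdivX k p.
Proof.
move=> dkl; apply/mpolyP => m; rewrite mcoeff_mdivX ['X_[l] * p]mulrC ['X_[l] *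
  _]mulrC !mcoeffMX_if.
have -> : (l <= m + k)%MM = (l <= m)%MM.
  apply/mnm_lepP/mnm_lepP => lm v; have := lm v; rewrite mnmDE.
    by case: (dkl v) => ->; rewrite ?addn0.
  by move=> h; apply: leq_trans h (leq_addr _ _).
case: ifP => // /mnm_lepP lm; rewrite mcoeff_mdivX; congr _@_ _.
apply/mnmP => v; rewrite !(mnmDE, mnmBE) addnBAC //; exact: lm.
Qed.

Definition prodX w : R := 'X_[[multinom (v \in w : nat) | v < N]].

Lemma prodXE w : \prod_(v in w) 'X_v = prodX w.
Proof.
rewrite /prodX mpolyXE_id big_mkcond; apply: eq_bigr => v _.
by rewrite mnmE; case: (v \in w).
Qed.

Lemma prodXU w1 w2 : [disjoint w1 & w2] -> prodX (w1 :|: w2) = prodX w1 * prodX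
  w2.
Proof.
move=> d12; rewrite -!prodXE -bigU //=; apply: eq_bigl => v.
by rewrite !inE.
Qed.

Lemma mdeg_set w : mdeg [multinom (v \in w : nat) | v < N] = #|w|.
Proof.
by rewrite mdegE -sum1_card [RHS]big_mkcond; apply: eq_bigr => v _;
  rewrite mnmE; case: (_ \in _).
Qed.

Lemma prodX_neq0 w : prodX w != 0.
Proof.
apply/eqP => /(congr1 (mcoeff [multinom (v \in w : nat) | v < N])) /eqP.
by rewrite mcoeffX eqxx mcoeff0 oner_eq0.
Qed.

Lemma prodX_coeff0 w : w != set0 -> (prodX w)@_0%MM = 0.
Proof.
rewrite /prodX mcoeffX => w0; case: eqP => // w_0.
by rewrite -cards_eq0 -mdeg_set w_0 mdeg0 eqxx in w0.
Qed.

Definition divset w : R -> R := mdivX [multinom (v \in w : nat) | v < N].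

HB.instance Definition _ w := GRing.Additive.on (divset w).

Lemma divsetM w p : divset w (prodX w * p) = p.
Proof. exact: mdivXMX. Qed.

Lemma divset_disjoint w1 w2 p : [disjoint w1 & w2] ->
  divset w1 (prodX w2 * p) = prodX w2 * divset w1 p.
Proof.
move=> d12; apply: mdivX_disjoint => v; rewrite !mnmE.
by have [v1|v1] := boolP (v \in w1); [rewrite (disjointFr d12 v1); right|left].
Qed.

(** The quotient is explicit: dividing by [prodX w2] recovers [p] on the left and commutes with
    [prodX w1] on the right. *)
Lemma prodX_coprime w1 w2 p q : [disjoint w1 & w2] ->
  prodX w2 * p = prodX w1 * q -> exists r, p = prodX w1 * r.
Proof.
move=> d12 e; exists (divset w2 q).
have d21 : [disjoint w2 & w1] by rewrite disjoint_sym.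
by rewrite -[LHS](divsetM w2) e (divset_disjoint _ d21).
Qed.

Lemma homog_of_degreeP d p :
  homog_of_degree d p <-> forall m, p@_m != 0 -> (mdeg m)%:Z = d.
Proof. by split=> h m; have := h m; rewrite mcoeff_msupp. Qed.

Lemma homog0 d : homog_of_degree d (0 : R).
Proof. by apply/homog_of_degreeP => m; rewrite mcoeff0 eqxx. Qed.

Lemma homogD d p q :
  homog_of_degree d p -> homog_of_degree d q -> homog_of_degree d (p + q).
Proof.
move=> /homog_of_degreeP hp /homog_of_degreeP hq; apply/homog_of_degreeP => m;
  rewrite mcoeffD.
by have [->|/hp//] := eqVneq p@_m 0; rewrite add0r => /hq.
Qed.

Lemma homogN d p : homog_of_degree d p -> homog_of_degree d (- p).
Proof. by move=> /homog_of_degreeP h; apply/homog_of_degreeP => m;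
  rewrite mcoeffN oppr_eq0 => /h. Qed.

Lemma homogM d e p q : homog_of_degree d p -> homog_of_degree e q ->
  homog_of_degree (d + e) (p * q).
Proof.
move=> /homog_of_degreeP hp /homog_of_degreeP hq m /msuppM_le /allpairsP[[x y]
  /= [xp yq ->]].
by rewrite mdegD PoszD hp ?hq // -mcoeff_msupp.
Qed.

Lemma homog1 : homog_of_degree 0 (1 : R).
Proof. by move=> m; rewrite msupp1 inE => /eqP ->; rewrite mdeg0. Qed.

Lemma homogX d p k : homog_of_degree d p -> homog_of_degree (d * k%:Z) (p ^+ k).
Proof.
move=> h; elim: k => [|k IH]; first by rewrite mulr0; exact: homog1.
by rewrite exprS intS mulrDr mulr1; apply: homogM.
Qed.

Lemma homog_prodX w : homog_of_degree #|w| (prodX w).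
Proof. by move=> m; rewrite msuppX inE => /eqP ->; rewrite mdeg_set. Qed.

Definition hcomp (d : int) p : R :=
  \sum_(m <- msupp p | (mdeg m)%:Z == d) p@_m *: 'X_[m].

Lemma mcoeff_hcomp d p m :
  (hcomp d p)@_m = if (mdeg m)%:Z == d then p@_m else 0.
Proof. by rewrite /hcomp (@mcoeff_sumX _ id _ _ m). Qed.

Lemma hcomp_zmod_morphism_subproof d : zmod_morphism (hcomp d).
Proof.
move=> p q; apply/mpolyP => m; rewrite mcoeffB !mcoeff_hcomp mcoeffB.
by case: ifP; rewrite ?subr0.
Qed.

HB.instance Definition _ d :=
  GRing.isZmodMorphism.Build R R (hcomp d) (hcomp_zmod_morphism_subproof d).

Lemma hcomp_homog d p : homog_of_degree d (hcomp d p).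
Proof.
by apply/homog_of_degreeP => m; rewrite mcoeff_hcomp; case: ifP => [/eqP //|_];
  rewrite eqxx.
Qed.

Lemma hcomp_id d p : homog_of_degree d p -> hcomp d p = p.
Proof.
move=> /homog_of_degreeP h; apply/mpolyP => m; rewrite mcoeff_hcomp;
  case: eqP => // md.
by have [//|/h] := eqVneq p@_m 0.
Qed.

Lemma hcompM d e p q : homog_of_degree e q ->
  hcomp (d + e) (p * q) = hcomp d p * q.
Proof.
move=> /homog_of_degreeP h; apply/mpolyP => m; rewrite mcoeff_hcomp !mcoeffM.
case: ifP => md; last first.
  rewrite big1 // => -[x y] /= /eqP mxy; rewrite mcoeff_hcomp.
  have [->|/h yd] := eqVneq q@_y 0; first by rewrite mulr0.
  case: eqP => xd; rewrite ?mul0r //.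
  by rewrite mxy mdegD PoszD xd yd eqxx in md.
apply: eq_bigr => -[x y] /= /eqP mxy; rewrite mcoeff_hcomp.
have [->|/h yd] := eqVneq q@_y 0; first by rewrite !mulr0.
by rewrite mxy mdegD PoszD yd (inj_eq (addIr e)) in md; rewrite md.
Qed.

(** Taking homogeneous components commutes with multiplication by the homogeneous entries of [M], so
    the component of degree [e - sh k] of each [w 0 k] again gives a solution. *)
Lemma homogeneous_lift r t (sh : 'I_r -> int) (sh' : 'I_t -> int)
    (M : 'M[R]_(r, t)) e (u : 'rV[R]_t) (w : 'rV[R]_r) :
    (forall k l, homog_of_degree (sh k - sh' l) (M k l)) ->
    (forall l, homog_of_degree (e - sh' l) (u 0 l)) ->
    u = w *m M ->
  exists2 w' : 'rV[R]_r,
    (forall k, homog_of_degree (e - sh k) (w' 0 k)) & u = w' *m M.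
Proof.
move=> hM hu uE; exists (\row_k hcomp (e - sh k) (w 0 k)).
  by move=> k; rewrite mxE; apply: hcomp_homog.
apply/rowP => l; rewrite -[LHS](hcomp_id (hu l)) uE !mxE raddf_sum /=.
apply: eq_bigr => k _; rewrite !mxE -(hcompM _ _ (hM k l)).
by rewrite addrA subrK.
Qed.

End Monomials.

(** * Exactness on the grid *)

Section Grid.

Variable R : idomainType.
Implicit Types (i j : nat).

(** Index -1 carries the value 0, so that boundary formulas need no separate case on the border of
    the grid. *)
Definition shift1 (f : nat -> R) j : R := if j is j'.+1 then f j' else 0.

(** Finite choice by induction on [n]; [x0] fills the indices from [n] on. *)
Lemma bounded_choice (T : Type) (x0 : T) n (P : nat -> T -> Prop) :
    (forall i, (i < n)%N -> exists x, P i x) ->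
  exists F : nat -> T, forall i, (i < n)%N -> P i (F i).
Proof.
elim: n => [|n IH] h; first by exists (fun=> x0).
have [i /ltnW|F hF] := IH; first exact: h.
have [x Px] := h n (ltnSn n).
exists (fun i => if i == n then x else F i) => i; rewrite ltnS leq_eqVlt.
by case: eqP => [-> //|_ /=]; apply: hF.
Qed.

Lemma coprime_expr (a c : R) :
    (forall p q, c * p = a * q -> exists r, p = a * r) ->
  forall k p q, c ^+ k * p = a * q -> exists r, p = a * r.
Proof.
move=> ac; elim=> [|k IH] p q; first by rewrite mul1r; exists q.
by rewrite exprS -mulrA => /ac[r /IH].
Qed.

(* The last coefficient y i is a multiple of a, so that subtracting a multiple
   of the relation between the last two generators lowers i. *)
Lemma power_syzygy (a c : R) :
    a != 0 -> (forall p q, c * p = a * q -> exists r, p = a * r) ->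
  forall i (y : nat -> R), \sum_(j < i.+1) a ^+ (i - j) * c ^+ j * y j = 0 ->
  exists2 w, (forall j, (i <= j)%N -> w j = 0) &
    forall j, (j <= i)%N -> y j = c * w j - a * shift1 w j.
Proof.
move=> a0 /coprime_expr ac; elim=> [|i IH] y.
  rewrite big_ord1 !mul1r => y0; exists (fun=> 0) => // j.
  by rewrite leqn0 => /eqP -> /=; rewrite y0 !mulr0 subr0.
have factor (z : nat -> R) : \sum_(j < i.+1) a ^+ (i.+1 - j) * c ^+ j * z j =
    a * \sum_(j < i.+1) a ^+ (i - j) * c ^+ j * z j.
  rewrite mulr_sumr; apply: eq_bigr => j _.
  by rewrite subSn ?exprS ?mulrA // -ltnS.
rewrite big_ord_recr /= factor subnn mul1r => /eqP; rewrite addrC addr_eq0.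
rewrite -mulrN => /eqP yE; have [r yr] := ac _ _ _ yE.
(* The last term a r is traded for c r at index i, which keeps the sum: c^(i+1) (a r) = a c^i (c
   r). *)
pose y' j := y j + (if j == i then c * r else 0).
have /IH[w w0 wE] : \sum_(j < i.+1) a ^+ (i - j) * c ^+ j * y' j = 0.
  apply: (mulfI a0); rewrite mulr0.
  move: yE; rewrite yr mulrN -[LHS]opprK => /oppr_inj.
  rewrite (mulrCA (c ^+ _)) -mulrN => /(mulfI a0) /eqP.
  rewrite eqr_oppLR -addr_eq0 => /eqP yE; apply/eqP;
    rewrite mulf_eq0 (negPf a0) /=.
  rewrite -[X in _ == X]yE !big_ord_recr /= /y' /= eqxx subnn mul1r; apply/eqP.
  under eq_bigr => j _ do rewrite (ltn_eqF (ltn_ord j)) addr0.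
  by rewrite exprSr; ring.
exists (fun j => if j == i then - r else w j) => [j ij|j].
  by rewrite gtn_eqF // w0 // ltnW.
rewrite leq_eqVlt => /predU1P[->|].
  by rewrite /= eqxx yr (gtn_eqF (ltnSn i)) w0 //; ring.
rewrite ltnS => ji; have := wE j ji; rewrite /y'; case: eqP => [-> |_].
  rewrite w0 // mulr0 sub0r => /eqP; rewrite -subr_eq0 => /eqP e.
  have -> : shift1 (fun j => if j == i then - r else w j) i = shift1 w i.
    by case: (i) => //= k; rewrite ltn_eqF.
  by apply/eqP; rewrite -subr_eq0 -{}e; apply/eqP; ring.
rewrite addr0 => ->; case: j ji => //= j ji.
by rewrite ltn_eqF.
Qed.

Variables (a b c d : R).
Variable s : nat.

(* The edge (i, j) joins the vertex (i, j) to (i, j + 1) or to (i + 1, j), and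
   the square (i, j) has these three and (i + 1, j + 1) as its corners. *)
Definition vertex i j := (j <= i <= s)%N.
Definition hedge i j := (j < i <= s)%N.
Definition vedge i j := (j <= i < s)%N.
Definition square i j := (j < i < s)%N.

Definition supported (P : rel nat) (u : nat -> nat -> R) :=
  forall i j, ~~ P i j -> u i j = 0.

(** The horizontal edge (i, j) is sent to a times its end (i, j + 1) minus c times its end (i, j),
    because a [gen i j.+1] = c [gen i j]. Likewise [vbd] rests on b [gen i.+1 j] = d [gen i j]. *)
Definition hbd (x : nat -> nat -> R) i j := a * shift1 (x i) j - c * x i j.
Definition vbd (y : nat -> nat -> R) i j :=
  b * shift1 (y^~ j) i - d * y i j.

Definition gen i j : R := a ^+ (s - j) * c ^+ j * (b ^+ (s - i) * d ^+ i).

(** Horizontal terms telescope along each row and vertical ones along each column; the supports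
    remove the terms at the far ends j = s and i = s. *)
Lemma gen_relation x y : supported hedge x -> supported vedge y ->
  \sum_(i < s.+1) \sum_(j < s.+1) (hbd x i j + vbd y i j) * gen i j = 0.
Proof.
move=> sx sy.
under eq_bigr => i _ do
  [under eq_bigr => j _ do rewrite mulrDl; rewrite big_split].
rewrite big_split /= [X in X + _]big1 => [|i _].
  rewrite add0r exchange_big /= big1 // => j _.
  rewrite /vbd; under eq_bigr => i _ do rewrite mulrBl.
  rewrite sumrB big_ord_recl /= mulr0 mul0r add0r.
  rewrite [X in _ - X]big_ord_recr /= (sy s) ?mulr0 ?mul0r ?addr0; last first.
    by rewrite /vedge ltnn andbF.
  apply/eqP; rewrite subr_eq0; apply/eqP; apply: eq_bigr => i _.
  rewrite /gen /bump /= add1n.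
  have -> : (s - i = (s - i.+1).+1)%N by have := ltn_ord i; lia.
  by rewrite !exprS; ring.
rewrite /hbd; under eq_bigr => j _ do rewrite mulrBl.
rewrite sumrB big_ord_recl /= mulr0 mul0r add0r.
rewrite [X in _ - X]big_ord_recr /= (sx i s) ?mulr0 ?mul0r ?addr0; last first.
  by rewrite /hedge -ltnS; have := ltn_ord i; lia.
apply/eqP; rewrite subr_eq0; apply/eqP; apply: eq_bigr => j _.
rewrite /gen /bump /= add1n.
have -> : (s - j = (s - j.+1).+1)%N by have := ltn_ord j; lia.
by rewrite !exprS; ring.
Qed.

Lemma bd_supported x y : supported hedge x -> supported vedge y ->
  supported vertex (fun i j => hbd x i j + vbd y i j).
Proof.
rewrite /vertex => sx sy i j vij; rewrite /hbd /vbd (sx i j) ?(sy i j) /hedge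
  /vedge; try lia.
have -> : shift1 (x i) j = 0 by case: j vij => //= j vij; apply: sx;
  rewrite /hedge; lia.
have -> : shift1 (y^~ j) i = 0.
  by case: i vij => //= i vij; apply: sy; rewrite /vedge; lia.
by ring.
Qed.

(** The two directions commute; the sign on the vertical edges turns this into a boundary of square
    zero. *)
Lemma bd_bd w i j :
  hbd (fun i j => vbd w i j) i j + vbd (fun i j => - hbd w i j) i j = 0.
Proof. by rewrite /hbd /vbd; case: i => [|i]; case: j => [|j] /=; ring. Qed.

Lemma square_bd_supported w : supported square w ->
  supported hedge (vbd w) /\ supported vedge (fun i j => - hbd w i j).
Proof.
rewrite /hedge /vedge => sw; split=> i j nij; rewrite /vbd /hbd sw.
- case: i nij => [|i] nij /=; first by ring.
  by rewrite sw /square; [ring|lia].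
- by rewrite /square; lia.
- case: j nij => [|j] nij /=; first by ring.
  by rewrite sw /square; [ring|lia].
- by rewrite /square; lia.
Qed.

(** The weights make consecutive terms cancel, and the vanishing of [f] from i on removes the last
    one. Up to sign this is the converse of [power_syzygy]. *)
Lemma hbd_weighted_sum (f : nat -> R) i : (forall j, (i <= j)%N -> f j = 0) ->
  \sum_(j < i.+1) a ^+ (i - j) * c ^+ j * (a * shift1 f j - c * f j) = 0.
Proof.
move=> f0; under eq_bigr => j _ do rewrite mulrBr.
rewrite sumrB big_ord_recl /= mulr0 mulr0 add0r.
rewrite [X in _ - X]big_ord_recr /= f0 // !mulr0 addr0.
apply/eqP; rewrite subr_eq0; apply/eqP; apply: eq_bigr => j _.
rewrite /bump /= add1n.
have -> : (i - j = (i - j.+1).+1)%N by have := ltn_ord j; lia.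
by rewrite !exprS; ring.
Qed.

(** Induction along the row: once the entry at j - 1 is 0, the equation at j reads c times the entry
    at j equals 0. *)
Lemma hbd_inj x : c != 0 ->
  (forall i j, hbd x i j = 0) -> forall i j, x i j = 0.
Proof.
move=> c0 x0 i; elim=> [|j IH]; apply: (mulfI c0); rewrite mulr0.
  by have /eqP := x0 i 0; rewrite /hbd /= mulr0 sub0r oppr_eq0 => /eqP.
by have /eqP := x0 i j.+1; rewrite /hbd /= IH mulr0 sub0r oppr_eq0 => /eqP.
Qed.

Hypothesis a0 : a != 0.
Hypothesis ac : forall p q, c * p = a * q -> exists r, p = a * r.

Lemma exact_edges x y : c != 0 -> d != 0 ->
    supported hedge x -> supported vedge y ->
    (forall i j, hbd x i j + vbd y i j = 0) ->
  exists w, [/\ supported square w, forall i j, x i j = vbd w i j &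
    forall i j, y i j = - hbd w i j].
Proof.
move=> c0 d0 sx sy xy0.
(* Weighting the equations of row i so that the horizontal terms telescope
   leaves d Y_i = a b Y_(i-1), hence Y = 0. *)
pose Y i := \sum_(j < i.+1) a ^+ (i - j) * c ^+ j * y i j.
have Y_rel i : b * \sum_(j < i.+1) a ^+ (i - j) * c ^+ j * shift1 (y^~ j) i
    = d * Y i.
  apply/eqP; rewrite -subr_eq0 /Y !mulr_sumr -sumrB; apply/eqP.
  rewrite -[RHS](@hbd_weighted_sum (fun j => - x i j) i) => [|j ij]; last first.
    by rewrite sx ?oppr0 // /hedge; lia.
  apply: eq_bigr => j _.
  have /eqP := xy0 i j; rewrite addr_eq0 => /eqP e.
  have -> : a * shift1 (fun j => - x i j) j - c * - x i j = vbd y i j.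
    by rewrite -[RHS]opprK -e /hbd; case: (nat_of_ord j) => /=; intros; ring.
  by rewrite /vbd; ring.
have Y0 i : Y i = 0.
  apply: (mulfI d0); rewrite mulr0 -Y_rel.
  elim: i => [|i IH] /=; first by rewrite big1 ?mulr0 // => j _; rewrite mulr0.
  rewrite big_ord_recr /= (sy i i.+1) ?mulr0 ?addr0; last by rewrite /vedge;
    lia.
  have -> : \sum_(j < i.+1) a ^+ (i.+1 - j) * c ^+ j * y i j = a * Y i.
    rewrite mulr_sumr; apply: eq_bigr => j _.
    by rewrite subSn ?exprS ?mulrA // -ltnS.
  suff -> : Y i = 0 by rewrite !mulr0.
  by apply: (mulfI d0); rewrite -Y_rel IH mulr0.
have [|W hW] := @bounded_choice _ (fun=> 0) s (fun i W =>
    (forall j, (i <= j)%N -> W j = 0) /\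
    forall j, (j <= i)%N -> y i j = c * W j - a * shift1 W j).
  by move=> i _; have [W] := power_syzygy a0 ac (Y0 i); exists W.
(* The choice says nothing about the rows from s on, where no square starts. *)
pose w i j := if (i < s)%N then W i j else 0.
have sw : supported square w.
  move=> i j; rewrite /square /w; case: (ltnP i s) => // is_.
  by rewrite andbT -leqNgt; have [h _] := hW i is_; apply: h.
have yE i j : y i j = - hbd w i j.
  rewrite /hbd /w; case: ltnP => is_; last first.
    by rewrite sy /vedge; [case: (j) => /=; intros; ring|lia].
  have [h hy] := hW i is_; have [ji|ij] := leqP j i; first by rewrite hy //;
    ring.
  rewrite sy /vedge; last by lia.
  case: j ij => // j ij /=; rewrite !h //; [by ring|exact: ltnW].
(* With y equal to minus the horizontal boundary of w, the difference between x and [vbd w] has zero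
   horizontal boundary, hence vanishes. *)
exists w; split=> // i j; apply/eqP; rewrite -subr_eq0; apply/eqP.
apply: (@hbd_inj (fun i j => x i j - vbd w i j) c0) => {}i {}j.
have := bd_bd w i j; have := xy0 i j.
have -> : vbd y i j = vbd (fun i j => - hbd w i j) i j.
  by rewrite /vbd yE; case: (i) => [|k] /=; rewrite ?yE.
move=> e1 e2; rewrite -[RHS](subrr 0) -{1}e1 -e2.
by rewrite /hbd; case: (j) => /=; intros; ring.
Qed.

Hypothesis b0 : b != 0.
Hypothesis bd : forall p q, d * p = b * q -> exists r, p = b * r.
(** Division by d in abstract form: a left inverse of multiplication by d that commutes with a and
    c. It is instantiated by [divset V2]. *)
Variable divd : {additive R -> R}.
Hypotheses (divdM : forall p, divd (d * p) = p)
  (divda : forall p, divd (a * p) = a * divd p)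
  (divdc : forall p, divd (c * p) = c * divd p).

Lemma divd_expr k l p :
  divd (a ^+ k * c ^+ l * p) = a ^+ k * c ^+ l * divd p.
Proof.
rewrite -!mulrA; elim: k => [|k IH].
  rewrite !mul1r; elim: l => [|l IH]; first by rewrite !mul1r.
  by rewrite exprS -!mulrA divdc IH.
by rewrite exprS -!mulrA divda IH.
Qed.

Lemma exact_vertices u : supported vertex u ->
    \sum_(i < s.+1) \sum_(j < s.+1) u i j * gen i j = 0 ->
  exists x y, [/\ supported hedge x, supported vedge y &
    forall i j, u i j = hbd x i j + vbd y i j].
Proof.
move=> su u_rel.
(* The row sums U satisfy a relation in (b, d), so U_i = d W_i - b W_(i-1), and
   dividing by d puts W_i in the span of the generators of row i. *)
pose ga j := a ^+ (s - j) * c ^+ j.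
pose U i := \sum_(j < s.+1) ga j * u i j.
have /(power_syzygy b0 bd)[W W0 WE] :
    \sum_(i < s.+1) b ^+ (s - i) * d ^+ i * U i = 0.
  rewrite -[RHS]u_rel; apply: eq_bigr => i _; rewrite mulr_sumr.
  by apply: eq_bigr => j _; rewrite /gen /ga; ring.
(* Row by row, z_i is (u_i + b z_(i-1)) divided by d entrywise. This imitates d W_i = U_i + b
   W_(i-1), so the weighted sum of z_i is W_i. *)
have [z zE] : exists z : nat -> nat -> R,
    forall i j, z i j = divd (u i j + b * shift1 (z^~ j) i).
  by exists (fix z i j := divd (u i j + b * shift1 (z^~ j) i)); case.
have zs i j : (i < j)%N -> z i j = 0.
  elim: i j => [|i IH] j ij.
    by rewrite zE su ?mulr0 ?addr0 ?raddf0 // /vertex; lia.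
  by rewrite zE /= IH ?(ltnW ij) // su ?mulr0 ?addr0 ?raddf0 // /vertex; lia.
have zW i : (i <= s)%N -> W i = \sum_(j < s.+1) ga j * z i j.
  elim: i => [|i IH] is_.
    rewrite -[LHS]divdM; have := WE 0 is_; rewrite /= mulr0 subr0 => <-.
    rewrite raddf_sum; apply: eq_bigr => j _ /=.
    by rewrite divd_expr zE /= mulr0 addr0.
  have : d * W i.+1 = U i.+1 + b * W i by rewrite (WE _ is_) /= subrK.
  move=> /(congr1 divd); rewrite divdM (IH (ltnW is_)) => ->.
  rewrite mulr_sumr -big_split raddf_sum; apply: eq_bigr => j _ /=.
  by rewrite [b * _]mulrCA -mulrDr divd_expr [in RHS]zE.
(* As W_s = 0, cutting z off at row s preserves the weighted sums W_i for i up to s, and it makes y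
   supported on the vertical edges. *)
pose y i j := if (i < s)%N then z i j else 0.
have sy : supported vedge y.
  move=> i j; rewrite /vedge /y; case: ltnP => // is_.
  by rewrite andbT -ltnNge => /zs.
have yW i : (i <= s)%N -> W i = \sum_(j < s.+1) ga j * y i j.
  move=> is_; rewrite /y; case: ltnP => si; first exact: zW.
  by rewrite W0 // big1 // => j _; rewrite mulr0.
(* The weighted sum of row i of u' is U_i + b W_(i-1) - d W_i = 0, so each row of u' is a syzygy of
   powers of a and c. *)
pose u' i j := u i j + vbd y i j.
have su' i j : (i <= s)%N -> (i < j)%N -> u' i j = 0.
  move=> is_ ij; rewrite /u' su /vbd ?(sy i j) /vertex /vedge; try lia.
  have -> : shift1 (y^~ j) i = 0.
    by case: i is_ ij => //= i is_ ij; apply: sy; rewrite /vedge; lia.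
  by ring.
have [|X hX] := @bounded_choice _ (fun=> 0) s.+1 (fun i X =>
    (forall j, (i <= j)%N -> X j = 0) /\
    forall j, (j <= i)%N -> u' i j = c * X j - a * shift1 X j).
  move=> i; rewrite ltnS => is_.
  suff /(power_syzygy a0 ac)[X] :
    \sum_(j < i.+1) a ^+ (i - j) * c ^+ j * u' i j = 0 by exists X.
  (* The factor a^(s-i) turns the weights a^(i-j) of [power_syzygy] into the weights a^(s-j) of the
     generators. *)
  apply: (mulfI (expf_neq0 (s - i) a0)); rewrite mulr0.
  transitivity (U i + b * shift1 W i - d * W i); last by rewrite WE //; ring.
  have -> : b * shift1 W i = \sum_(j < s.+1) ga j * (b * shift1 (y^~ j) i).
    case: i is_ => [|i] is_ /=.
      by rewrite big1 ?mulr0 // => j _; rewrite !mulr0.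
    rewrite yW 1?ltnW // mulr_sumr.
    by apply: eq_bigr => j _; rewrite mulrCA.
  rewrite yW // [d * _]mulr_sumr -big_split -sumrB /=.
  have is1 : (i.+1 <= s.+1)%N by [].
  rewrite (big_ord_widen _ (fun j => a ^+ (i - j) * c ^+ j * u' i j) is1).
  rewrite mulr_sumr big_mkcond; apply: eq_bigr => j _ /=.
  rewrite /ga; case: ltnP => ij.
    have -> : (s - j = (s - i) + (i - j))%N by lia.
    by rewrite exprD /u' /vbd; ring.
  have /eqP := su' _ _ is_ ij; rewrite /u' addr_eq0 => /eqP ->.
  by rewrite /vbd; ring.
(* Both signs change: [power_syzygy] yields c X - a [shift1 X], the opposite of [hbd], and u equals
   u' minus [vbd y]. *)
pose x i j := if (i <= s)%N then - X i j else 0.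
pose y' i j := - y i j.
have y'E i j : vbd y' i j = - vbd y i j.
  by rewrite /vbd /y'; case: i => /=; intros; ring.
exists x, y'; split.
- move=> i j; rewrite /x /hedge; case: (leqP i s) => //= is_;
    rewrite ?andbT -?leqNgt.
  by have [h _] := hX i is_; move=> /h ->; rewrite oppr0.
- by move=> i j nij; rewrite /y' sy ?oppr0.
move=> i j; rewrite y'E.
have [vij|nv] := boolP (vertex i j).
  have /andP[ji is_] := vij; have [_ h] := hX i is_.
  have := h _ ji; rewrite /u' => /(canRL (addrK _)) ->.
  congr (_ + _); rewrite /hbd /x is_.
  case: (j) => /= [|k]; ring.
rewrite su // /hbd /vbd (sy i j) ?/x; last by rewrite /vedge /vertex in nv *;
  lia.
have -> : shift1 (y^~ j) i = 0.
  by case: i nv => //= i nv; apply: sy; rewrite /vedge /vertex in nv *; lia.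
case: ifP => is_; last by case: (j) => /=; intros; ring.
have [h _] := hX i is_.
rewrite /vertex is_ andbT -ltnNge in nv.
case: j nv => //= j nv; rewrite !h //; last exact: ltnW.
by ring.
Qed.

End Grid.

(** * Comparison of resolutions *)

Section Comparison.

Variables (K : fieldType) (N : nat).
Local Notation R := {mpoly K[N]}.
Implicit Types (A B : R -> Prop) (F : free_complex K N).

(** The matrices of degree-preserving maps between graded free modules with basis degrees [sh] and
    [sh']. *)
Definition homog_mx r t (sh : 'I_r -> int) (sh' : 'I_t -> int)
  (M : 'M[R]_(r, t)) := forall k l, homog_of_degree (sh k - sh' l) (M k l).

Lemma homog_mxM r t q (sh : 'I_r -> int) (sh' : 'I_t -> int)
    (sh'' : 'I_q -> int) M M' :
  homog_mx sh sh' M -> homog_mx sh' sh'' M' -> homog_mx sh sh'' (M *m M').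
Proof.
move=> hM hM' k l; rewrite mxE; apply: big_ind => [||x _].
- exact: homog0.
- exact: homogD.
by rewrite -(subrKA (sh' x)); apply: homogM.
Qed.

(** Projectivity of free modules in matrix form: a map lifts as soon as the image of each basis
    element does. *)
Lemma row_lift r t q (M : 'M[R]_(t, q)) (A : 'M[R]_(r, q)) :
    (forall k, exists w, row k A = w *m M) ->
  exists W, A = W *m M.
Proof.
move=> /fin_all_exists[W WE]; exists (\matrix_k W k).
by apply/row_matrixP => k; rewrite WE row_mul rowK.
Qed.

Lemma homog_row_lift r t q (sh : 'I_r -> int) (sh' : 'I_t -> int)
    (sh'' : 'I_q -> int) (M : 'M[R]_(t, q)) (A : 'M[R]_(r, q)) :
    homog_mx sh' sh'' M -> homog_mx sh sh'' A ->
    (forall k, exists w, row k A = w *m M) ->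
  exists2 W, homog_mx sh sh' W & A = W *m M.
Proof.
move=> hM hA AM.
have /fin_all_exists[W WE] k : exists w : 'rV_t,
    (forall l, homog_of_degree (sh k - sh' l) (w 0 l)) /\ row k A = w *m M.
  have [w e] := AM k; have [|w' hw' e'] := homogeneous_lift (e := sh k) hM _ e.
    by move=> l; rewrite mxE.
  by exists w'.
exists (\matrix_k W k) => [k l|].
  by rewrite mxE; have [h _] := WE k; apply: h.
by apply/row_matrixP => k; have [_ ->] := WE k; rewrite row_mul rowK.
Qed.

Section Fixed.

Variables (A : R -> Prop) (F G : free_complex K N).
Hypotheses (resF : graded_resolution A (@zero_ideal K N) F)
           (resG : graded_resolution A (@zero_ideal K N) G).

Let homog_diff H (resH : graded_resolution A (@zero_ideal K N) H) i :
  homog_mx (@shift _ _ H i.+1) (@shift _ _ H i) (diff H i).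
Proof. by have [e [_ h _ _ _]] := resH => k l; apply: h. Qed.

Let exact_diff H (resH : graded_resolution A (@zero_ideal K N) H) i
    (u : 'rV[R]_(rank H i.+1)) :
  u *m diff H i = 0 -> exists w, u = w *m diff H i.+1.
Proof. by have [e [_ _ _ _ h]] := resH => /h. Qed.

Let diff_diff H (resH : graded_resolution A (@zero_ideal K N) H) i :
  diff H i.+1 *m diff H i = 0.
Proof.
have [e [_ _ _ _ h]] := resH; apply/row_matrixP => k.
by rewrite row_mul row0; apply/h; exists (delta_mx 0 k); rewrite -rowE.
Qed.

(* phi : G -> F and psi : F -> G lift the identity of A, and phi psi - 1 is
   h d + S where S = d h' comes from the previous homotopy h'. *)
Definition comparison_at i := exists
  (phi : 'M[R]_(rank G i, rank F i)) (phi' : 'M[R]_(rank G i.+1, rank F i.+1))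
  (psi : 'M[R]_(rank F i, rank G i)) (psi' : 'M[R]_(rank F i.+1, rank G i.+1))
  (h : 'M[R]_(rank G i, rank G i.+1)) (S : 'M[R]_(rank G i)),
  [/\ homog_mx (@shift _ _ G i) (@shift _ _ F i) phi,
      homog_mx (@shift _ _ G i.+1) (@shift _ _ F i.+1) phi',
      diff G i *m phi = phi' *m diff F i /\ diff F i *m psi = psi' *m diff G i,
      phi *m psi = 1%:M + h *m diff G i + S &
      diff G i *m S = 0 /\
      forall v : 'rV[K]_(rank G i), cycleK v ->
        v *m map_mx (mcoeff 0%MM) S = 0].

(** The identity of A is lifted through the augmentations [e] and [e']. No homotopy precedes, so S =
    0, and phi psi - 1 factors through the differential because its composite with [e'] is zero. *)
Lemma comparison0 : comparison_at 0.
Proof.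
have [e [eF _ AF kF _]] := resF; have [e' [eG _ AG kG _]] := resG.
have eqF (u : 'rV_(rank F 0)) : (u *m e) 0 0 = 0 -> exists w, u = w *m diff F 0.
  by case: (kF u) => h _; exact: h.
have eqG (u : 'rV_(rank G 0)) : (u *m e') 0 0 = 0 -> exists w,
  u = w *m diff G 0.
  by case: (kG u) => h _; exact: h.
have dF : diff F 0 *m e = 0.
  apply/row_matrixP => k; rewrite row_mul row0; apply/rowP => o.
  rewrite ord1 [RHS]mxE; case: (kF (row k (diff F 0))) => _; apply;
    exists (delta_mx 0 k).
  by rewrite -rowE.
have dG : diff G 0 *m e' = 0.
  apply/row_matrixP => k; rewrite row_mul row0; apply/rowP => o.
  rewrite ord1 [RHS]mxE; case: (kG (row k (diff G 0))) => _; apply;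
    exists (delta_mx 0 k).
  by rewrite -rowE.
have eA k : A (e k 0).
  apply/AF; exists (delta_mx 0 k), 0; split=> //.
  by rewrite -rowE mxE addr0.
have e'A k : A (e' k 0).
  apply/AG; exists (delta_mx 0 k), 0; split=> //.
  by rewrite -rowE mxE addr0.
have [phi hphi phiE] : exists2 phi, homog_mx (@shift _ _ G 0) (@shift _ _ F 0)
  phi
    & e' = phi *m e.
  apply: (@homog_row_lift _ _ _ _ _ (fun=> 0)).
  - by move=> k l; rewrite subr0 ord1; apply: eF.
  - by move=> k l; rewrite subr0 ord1; apply: eG.
  move=> k; have /AF[u [b [-> ue]]] := e'A k; exists u.
  by apply/rowP => o; rewrite ord1 mxE ue addr0.
have [psi psiE] : exists psi, e = psi *m e'.
  apply: row_lift => k; have /AG[u [b [-> ue]]] := eA k; exists u.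
  by apply/rowP => o; rewrite ord1 mxE ue addr0.
have [phi' hphi' phi'E] :
    exists2 phi', homog_mx (@shift _ _ G 1) (@shift _ _ F 1) phi' &
      diff G 0 *m phi = phi' *m diff F 0.
  apply: homog_row_lift; [exact: homog_diff|apply: homog_mxM hphi;
    exact: homog_diff|].
  move=> k; apply: eqF.
  by rewrite -row_mul -mulmxA -phiE dG row0 mxE.
have [psi' psi'E] : exists psi', diff F 0 *m psi = psi' *m diff G 0.
  apply: row_lift => k; apply: eqG.
  by rewrite -row_mul -mulmxA -psiE dF row0 mxE.
have [h hE] : exists h, phi *m psi - 1%:M = h *m diff G 0.
  apply: row_lift => k; apply: eqG.
  by rewrite -row_mul mulmxBl -mulmxA -psiE -phiE mul1mx subrr row0 mxE.
exists phi, phi', psi, psi', h, 0; split=> //.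
- by rewrite addr0 -hE addrC subrK.
- by split=> [|v _]; rewrite ?mulmx0 // map_mx0 mulmx0.
Qed.

(** The new homotopy exists because phi' psi' - 1 - d h is killed by d: phi' psi' d = d phi psi = d
    + d h d + d S, and d S = 0. The next S is d h, whose reduction kills cycles since its first
    factor does. *)
Lemma comparisonS i : comparison_at i -> comparison_at i.+1.
Proof.
case=> phi [phi' [psi [psi' [h [S [hphi hphi' [phiE psiE] hE [dS _]]]]]]].
have [phi2 hphi2 phi2E] :
    exists2 phi2, homog_mx (@shift _ _ G i.+2) (@shift _ _ F i.+2) phi2 &
      diff G i.+1 *m phi' = phi2 *m diff F i.+1.
  apply: homog_row_lift; [exact: homog_diff|apply: homog_mxM hphi';
    exact: homog_diff|].
  move=> k; apply: (exact_diff resF).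
  by rewrite -row_mul -mulmxA -phiE mulmxA diff_diff // mul0mx row0.
have [psi2 psi2E] : exists psi2, diff F i.+1 *m psi' = psi2 *m diff G i.+1.
  apply: row_lift => k; apply: (exact_diff resG).
  by rewrite -row_mul -mulmxA -psiE mulmxA diff_diff // mul0mx row0.
have [h' h'E] : exists h', phi' *m psi' - 1%:M - diff G i *m h = h' *m diff G
  i.+1.
  apply: row_lift => k; apply: (exact_diff resG).
  rewrite -row_mul !mulmxBl -mulmxA -psiE mulmxA -phiE mul1mx -mulmxA hE.
  rewrite !mulmxDr mulmx1 dS addr0 mulmxA.
  by rewrite [X in X - _ - _]addrC addrK subrr row0.
exists phi', phi2, psi', psi2, h', (diff G i *m h); split=> //.
- by rewrite -h'E [1%:M + _]addrC -addrA [1%:M + _]addrC addrA !subrK.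
- split=> [|v /= v0]; first by rewrite mulmxA diff_diff // mul0mx.
  by rewrite map_mxM mulmxA -/(diffK G i) v0 mul0mx.
Qed.

(** Reduced modulo the variables, phi does not kill the class v: otherwise the homotopy formula
    would give v = - (v h) d, a boundary. Hence some entry of phi between degree j and a shift of F
    has a nonzero constant term, and homogeneity makes the two degrees equal. *)
Lemma tor_shift i (j : int) : homologyK_neq0 G i j ->
  exists k : 'I_(rank F i), shift k = j.
Proof.
case=> v [vj vcyc vnb].
have [phi [phi' [psi [psi' [h [S [hphi _ _ hE [_ vS]]]]]]]] : comparison_at i.
  by elim: (i) => [|k]; [exact: comparison0|exact: comparisonS].
set c0 := mcoeff (0%MM : 'X_{1..N}) in vS *.
have [v0|] := eqVneq (v *m map_mx c0 phi) 0.
  case: vnb; exists (- (v *m map_mx c0 h)).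
  have := congr1 (fun M => v *m map_mx c0 M) hE.
  rewrite !map_mxD !map_mxM mulmxA v0 mul0mx map_mx1 !mulmxDr mulmx1 vS //
    addr0.
  by rewrite mulmxA mulNmx => /esym /eqP; rewrite addr_eq0 => /eqP.
case/rV0Pn => l; rewrite mxE => nz.
have /existsP[k] : [exists k, v 0 k * map_mx c0 phi k l != 0].
  apply: contraNT nz; rewrite negb_exists => /forallP z.
  by rewrite big1 // => k _; apply/eqP; rewrite -[_ == _]negbK.
rewrite mxE mulf_eq0 negb_or => /andP[/vj <- phi0]; exists l.
have := (homog_of_degreeP _ _).1 (hphi k l) _ phi0; rewrite mdeg0 => /esym /eqP.
by rewrite subr_eq0 => /eqP.
Qed.

End Fixed.
End Comparison.

(** * Complexes indexed by cells *)

Section CellComplex.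

Variables (K : fieldType) (N : nat) (T : nat -> finType).
Local Notation R := {mpoly K[N]}.
Variables (sh : forall i, T i -> int) (D : forall i, T i.+1 -> T i -> R).

Definition cell_complex : free_complex K N :=
  @FreeComplex K N (fun i => #|T i|) (fun i k => sh (enum_val k))
    (fun i => \matrix_(k, l) D (enum_val k) (enum_val l)).

Lemma sum_enum_rank i (v : 'rV[R]_#|T i|) (f : T i -> R) :
  \sum_k v 0 k * f (enum_val k) = \sum_t v 0 (enum_rank t) * f t.
Proof.
rewrite [RHS](reindex _ (onW_bij _ (enum_val_bij (T i)))).
by apply: eq_bigr => k _; rewrite enum_valK.
Qed.

Lemma cell_mulmx i (v : 'rV[R]_#|T i.+1|) l :
  (v *m diff cell_complex i) 0 l = \sum_t v 0 (enum_rank t) * D t (enum_val l).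
Proof.
rewrite mxE -(sum_enum_rank v (fun t => D t (enum_val l))).
by apply: eq_bigr => k _; rewrite mxE.
Qed.

(** Restates exactness with functions on cells, so that the enumeration of the bases by ordinals is
    dealt with once. *)
Lemma cell_complex_resolution (A B : R -> Prop) (eps : T 0 -> R) :
    (forall t, homog_of_degree (sh t) (eps t)) ->
    (forall i (t : T i.+1) (t' : T i), homog_of_degree (sh t - sh t') (D t t'))
      ->
    (forall p, A p <-> exists (u : T 0 -> R) b,
       B b /\ p = \sum_t u t * eps t + b) ->
    (forall u : T 0 -> R, B (\sum_t u t * eps t) <->
       exists w : T 1 -> R, forall t, u t = \sum_r w r * D r t) ->
    (forall i (u : T i.+1 -> R), (forall t, \sum_r u r * D r t = 0) <->
       exists w : T i.+2 -> R, forall t, u t = \sum_r w r * D r t) ->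
  graded_resolution A B cell_complex.
Proof.
move=> hsh hD hA hB hex.
have epsE (v : 'rV[R]_#|T 0|) :
    (v *m (\col_k eps (enum_val k))) 0 0 = \sum_t v 0 (enum_rank t) * eps t.
  rewrite mxE -(sum_enum_rank v eps).
  by apply: eq_bigr => k _; rewrite mxE.
have imageE i (v : 'rV[R]_#|T i|) :
    (exists w, v = w *m diff cell_complex i) <->
    exists w : T i.+1 -> R, forall t, v 0 (enum_rank t) = \sum_r w r * D r t.
  split=> [[w ->]|[w wE]].
    by exists (fun t => w 0 (enum_rank t)) => t; rewrite cell_mulmx enum_rankK.
  exists (\row_k w (enum_val k)); apply/rowP => l; rewrite cell_mulmx.
  rewrite -{1}(enum_valK l) wE; apply: eq_bigr => r _.
  by rewrite mxE enum_rankK.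
exists (\col_k eps (enum_val k)); split.
- by move=> k; rewrite mxE; apply: hsh.
- by move=> i k l; rewrite mxE; apply: hD.
- move=> p; split=> [/hA[u [b [Bb ->]]]|[u [b [Bb ->]]]].
    exists (\row_k u (enum_val k)), b; split=> //; congr (_ + _).
    by rewrite epsE; apply: eq_bigr => t _; rewrite mxE enum_rankK.
  by apply/hA; exists (fun t => u 0 (enum_rank t)), b; rewrite -epsE.
- by move=> u; rewrite epsE imageE; apply: hB.
move=> i u; rewrite (imageE i.+1 u) -hex; split=> [u0 t|u0].
  by have := congr1 (fun M : 'rV_(#|T i|) => M 0 (enum_rank t)) u0;
    rewrite cell_mulmx mxE enum_rankK.
by apply/rowP => l; rewrite cell_mulmx u0 mxE.
Qed.

End CellComplex.

(** * Cells of the staircase and functions on the grid *)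

Section Cells.

Variables (R : idomainType) (s : nat).
Implicit Type P : rel nat.

Lemma grid_eq (p q : 'I_s.+1 * 'I_s.+1) :
  val p.1 = val q.1 -> val p.2 = val q.2 -> p = q.
Proof. by case: p q => [i j] [k l] /= /val_inj -> /val_inj ->. Qed.

Definition cell P := {p : 'I_s.+1 * 'I_s.+1 | P p.1 p.2}.

(* Extension by zero of a function on cells to all of nat * nat. *)
Definition ext P (u : cell P -> R) i j : R :=
  \sum_(t : cell P) u t *+ ((val (val t).1 == i) && (val (val t).2 == j)).

Lemma ext_cell P (u : cell P -> R) (t : cell P) : ext u (val t).1 (val t).2 = u
  t.
Proof.
rewrite /ext (bigD1 t) //= !eqxx big1 ?addr0 // => r rt.
case: andP => // -[/eqP e1 /eqP e2]; case/eqP: rt; apply: val_inj.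
exact: grid_eq.
Qed.

Lemma ext_supported P (u : cell P -> R) : supported P (ext u).
Proof.
move=> i j Pij; rewrite /ext big1 // => -[[i' j'] /= Pij' _].
by case: andP => // -[/eqP ei /eqP ej]; rewrite -ei -ej Pij' in Pij.
Qed.

Lemma cellP P i j : (forall i j, P i j -> (i <= s)%N && (j <= s)%N) ->
  P i j -> exists t : cell P, (val t).1 = i :> nat /\ (val t).2 = j :> nat.
Proof.
move=> Ps Pij; have /andP[si sj] := Ps _ _ Pij.
pose p := (Ordinal (si : (i < s.+1)%N), Ordinal (sj : (j < s.+1)%N)).
by exists (exist (fun p => P (val p.1) (val p.2)) p Pij).
Qed.

Lemma ext_eq P (u : cell P -> R) f :
    (forall i j, P i j -> (i <= s)%N && (j <= s)%N) -> supported P f ->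
    (forall t : cell P, u t = f (val t).1 (val t).2) ->
  forall i j, ext u i j = f i j.
Proof.
move=> Ps sf uf i j; have [Pij|nP] := boolP (P i j); last first.
  by rewrite ext_supported ?sf.
have [t [<- <-]] := cellP Ps Pij.
by rewrite ext_cell uf.
Qed.

Lemma supported_eq0 P (f : nat -> nat -> R) :
    (forall i j, P i j -> (i <= s)%N && (j <= s)%N) -> supported P f ->
    (forall t : cell P, f (val t).1 (val t).2 = 0) ->
  forall i j, f i j = 0.
Proof.
move=> Ps sf f0 i j.
rewrite -(@ext_eq P (fun=> 0) f Ps sf (fun t => esym (f0 t)) i j).
by rewrite /ext big1 // => t _; rewrite mul0rn.
Qed.

Lemma ext_sum P (u : cell P -> R) h :
  \sum_(t : cell P) u t * h (val t).1 (val t).2 =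
  \sum_(i < s.+1) \sum_(j < s.+1) ext u i j * h i j.
Proof.
rewrite pair_big /=; under [RHS]eq_bigr => p _ do rewrite /ext mulr_suml.
rewrite exchange_big; apply: eq_bigr => t _ /=.
rewrite (bigD1 (val t)) //= !eqxx big1 ?addr0 // => p pt.
case: andP => [[/eqP e1 /eqP e2]|]; last by rewrite mul0r.
by case/eqP: pt; apply: grid_eq.
Qed.

Lemma ext_shift_col P (u : cell P -> R) i j :
  \sum_(t : cell P) u t *+ ((val (val t).1 == i) && ((val (val t).2).+1 == j)) =
  shift1 (ext u i) j.
Proof. by case: j => [|j] //; rewrite big1 // => t _; rewrite andbF. Qed.

Lemma ext_shift_row P (u : cell P -> R) i j :
  \sum_(t : cell P) u t *+ (((val (val t).1).+1 == i) && (val (val t).2 == j)) =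
  shift1 ((ext u)^~ j) i.
Proof. by case: i => [|i] //; rewrite big1. Qed.

Variables a b c d : R.

(** The matrix entries of [hbd], on bare grid positions so that they serve both from edges to
    vertices and from squares to edges. *)
Definition hcoef (e v : 'I_s.+1 * 'I_s.+1) : R :=
  a *+ ((val e.1 == v.1) && ((val e.2).+1 == v.2)) -
  c *+ ((val e.1 == v.1) && (val e.2 == v.2)).

Definition vcoef (e v : 'I_s.+1 * 'I_s.+1) : R :=
  b *+ (((val e.1).+1 == v.1) && (val e.2 == v.2)) -
  d *+ ((val e.1 == v.1) && (val e.2 == v.2)).

Lemma sum_hcoef P (x : cell P -> R) v :
  \sum_(e : cell P) x e * hcoef (val e) v = hbd a c (ext x) v.1 v.2.
Proof.
rewrite /hbd -ext_shift_col /ext !mulr_sumr -sumrB; apply: eq_bigr => e _.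
by rewrite mulrBr !mulrnAr (mulrC a) (mulrC c).
Qed.

Lemma sum_vcoef P (y : cell P -> R) v :
  \sum_(f : cell P) y f * vcoef (val f) v = vbd b d (ext y) v.1 v.2.
Proof.
rewrite /vbd -ext_shift_row /ext !mulr_sumr -sumrB; apply: eq_bigr => e _.
by rewrite mulrBr !mulrnAr (mulrC b) (mulrC d).
Qed.

Lemma card_cell P : #|{: cell P}| =
  (\sum_(i < s.+1) \sum_(j < s.+1) P i j)%N.
Proof.
rewrite card_sig -sum1_card pair_big /= big_mkcond; apply: eq_bigr => p _.
by rewrite inE; case: (P _ _).
Qed.

End Cells.

Lemma sum_ltn n k : (k <= n -> \sum_(j < n) (j < k) = k)%N.
Proof.
move=> kn; rewrite -(big_mkord xpredT (fun j => nat_of_bool (j < k)%N)).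
rewrite (@big_cat_nat _ _ _ k) //= big_nat.
rewrite (eq_bigr (fun=> 1%N)) => [|j /andP[_ ->]] //.
rewrite -big_nat sum_nat_const_nat muln1 subn0 big_nat big1 ?addn0 // =>
  j /andP[kj _].
by rewrite ltnNge kj.
Qed.

Lemma sum_ord_bin n : (\sum_(i < n) i = 'C(n, 2))%N.
Proof. by rewrite -bin2_sum big_mkord. Qed.

(** Row i holds i + 1 vertices and i horizontal edges for i <= s, and i + 1 vertical edges and i
    squares for i < s; each count is a sum of consecutive integers. *)
Lemma card_vertices s : #|{: cell s (vertex s)}| = 'C(s + 2, 2).
Proof.
rewrite card_cell addn2 -sum_ord_bin [RHS]big_ord_recl add0n;
  apply: eq_bigr => i _.
rewrite -[RHS](@sum_ltn s.+1) //=; apply: eq_bigr => j _.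
by rewrite /vertex -[(i <= s)%N]ltnS ltn_ord andbT.
Qed.

Lemma card_hedges s : #|{: cell s (hedge s)}| = 'C(s + 1, 2).
Proof.
rewrite card_cell addn1 -sum_ord_bin; apply: eq_bigr => i _.
rewrite -[RHS](@sum_ltn s.+1) 1?ltnW //; apply: eq_bigr => j _.
by rewrite /hedge -[(i <= s)%N]ltnS ltn_ord andbT.
Qed.

Lemma card_vedges s : #|{: cell s (vedge s)}| = 'C(s + 1, 2).
Proof.
rewrite card_cell addn1 -sum_ord_bin big_ord_recr [RHS]big_ord_recl /=.
rewrite [X in (_ + X)%N]big1 ?addn0 => [|j _];
  last by rewrite /vedge ltnn andbF.
rewrite add0n; apply: eq_bigr => i _.
rewrite -[RHS](@sum_ltn s.+1) //=; last by rewrite /bump leqW // leqW.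
apply: eq_bigr => j _.
by rewrite /vedge ltn_ord andbT ltnS.
Qed.

Lemma card_squares s : #|{: cell s (square s)}| = 'C(s, 2).
Proof.
rewrite card_cell -sum_ord_bin big_ord_recr /=.
rewrite [X in (_ + X)%N]big1 ?addn0 => [|j _];
  last by rewrite /square ltnn andbF.
apply: eq_bigr => i _; rewrite -[RHS](@sum_ltn s.+1) //=;
  last by rewrite leqW // ltnW.
by apply: eq_bigr => j _; rewrite /square ltn_ord andbT.
Qed.

(** * The staircase complex *)

Section GridComplex.

Variables (K : fieldType) (N : nat) (U1 U2 V1 V2 : {set 'I_N}) (s : nat).
Local Notation R := {mpoly K[N]}.
Hypotheses (U1_neq0 : U1 != set0) (U2_neq0 : U2 != set0)
  (V1_neq0 : V1 != set0) (V2_neq0 : V2 != set0).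
Hypotheses (dU1V1 : [disjoint U1 & V1]) (dU2V2 : [disjoint U2 & V2])
  (dU1V2 : [disjoint U1 & V2]) (dV1V2 : [disjoint V1 & V2]).

Local Notation a := (prodX K U1).
Local Notation b := (prodX K U2).
Local Notation c := (prodX K V1).
Local Notation d := (prodX K V2).

Definition gcell i : finType :=
  match i with
  | 0 => cell s (vertex s)
  | 1 => (cell s (hedge s) + cell s (vedge s))%type
  | 2 => cell s (square s)
  | _ => void
  end.

(** For a cell at (i, j), p and q record whether it extends in the direction of j and of i; the
    least common multiple then gains a factor c or d. *)
Definition grid_degree (p q i j : nat) : nat :=
  ((s - j) * #|U1| + (s - i) * #|U2| + (j + p) * #|V1| + (i + q) * #|V2|)%N.

(* The degree of the least common multiple of the generators at the vertices
   of a cell. *)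
Definition gdeg i : gcell i -> int :=
  match i return gcell i -> int with
  | 0 => fun t => grid_degree 0 0 (val t).1 (val t).2
  | 1 => fun t => match t with
                  | inl e => grid_degree 1 0 (val e).1 (val e).2
                  | inr f => grid_degree 0 1 (val f).1 (val f).2
                  end
  | 2 => fun t => grid_degree 1 1 (val t).1 (val t).2
  | _ => fun=> 0
  end.

(** The sign from squares to vertical edges is the one of [bd_bd]. *)
Definition gbd i : gcell i.+1 -> gcell i -> R :=
  match i return gcell i.+1 -> gcell i -> R with
  | 0 => fun t v => match t with
                    | inl e => hcoef a c (val e) (val v)
                    | inr f => vcoef b d (val f) (val v)
                    end
  | 1 => fun q t => match t with
                    | inl e => vcoef b d (val q) (val e)
                    | inr f => - hcoef a c (val q) (val f)
                    end
  | _ => fun _ _ => 0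
  end.

Definition ggen (v : gcell 0) : R := gen a b c d s (val v).1 (val v).2.

Lemma homog_cast (e f : int) (p : R) :
  homog_of_degree e p -> e = f -> homog_of_degree f p.
Proof. by move=> h <-. Qed.

Lemma homog_if (e : int) (p : R) (B : bool) :
  (B -> homog_of_degree e p) -> homog_of_degree e (p *+ B).
Proof. by case: B => h; [apply: h | apply: homog0]. Qed.

Lemma homog_ggen v : homog_of_degree (gdeg v) (ggen v).
Proof.
rewrite /ggen /gen; apply: homog_cast.
  by do !apply: homogM; apply: homogX; apply: homog_prodX.
by rewrite /= /grid_degree !addn0 !PoszD !PoszM; ring.
Qed.

(** The bound on [e.2] keeps s - j positive, so passing to j + 1 really removes one factor a.
    Leaving q free covers edges and squares together. *)
Lemma homog_hcoef p q (e v : 'I_s.+1 * 'I_s.+1) : (e.2 < s)%N ->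
  homog_of_degree
    ((grid_degree p.+1 q e.1 e.2)%:Z - (grid_degree p q v.1 v.2)%:Z)
    (hcoef a c e v).
Proof.
case: e v => [i j] [k l] /= js; rewrite /hcoef /=; apply: homogD => [|].
  apply: homog_if => /andP[/eqP ei /eqP ej].
  apply: homog_cast; first exact: homog_prodX.
  rewrite /grid_degree -ei -ej (_ : (s - j = (s - j.+1).+1)%N); last by lia.
  by rewrite addSnnS mulSn !PoszD; ring.
apply: homogN; apply: homog_if => /andP[/eqP ei /eqP ej].
apply: homog_cast; first exact: homog_prodX.
by rewrite /grid_degree -ei -ej addnS mulSn !PoszD; ring.
Qed.

Lemma homog_vcoef p q (e v : 'I_s.+1 * 'I_s.+1) : (e.1 < s)%N ->
  homog_of_degree
    ((grid_degree p q.+1 e.1 e.2)%:Z - (grid_degree p q v.1 v.2)%:Z)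
    (vcoef b d e v).
Proof.
case: e v => [i j] [k l] /= js; rewrite /vcoef /=; apply: homogD => [|].
  apply: homog_if => /andP[/eqP ei /eqP ej].
  apply: homog_cast; first exact: homog_prodX.
  rewrite /grid_degree -ei -ej (_ : (s - i = (s - i.+1).+1)%N); last by lia.
  by rewrite addSnnS mulSn !PoszD; ring.
apply: homogN; apply: homog_if => /andP[/eqP ei /eqP ej].
apply: homog_cast; first exact: homog_prodX.
by rewrite /grid_degree -ei -ej addnS mulSn !PoszD; ring.
Qed.

Lemma homog_gbd i (t : gcell i.+1) (t' : gcell i) :
  homog_of_degree (gdeg t - gdeg t') (gbd t t').
Proof.
case: i t t' => [|[|[|i]]] //=.
- case=> [e|f] v; [apply: homog_hcoef|apply: homog_vcoef].
    by have /andP[h /(leq_trans h)] := valP e.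
  by have /andP[] := valP f.
- move=> q; have /andP[ji i_s] := valP q.
  case=> [e|f]; [exact: homog_vcoef|apply: homogN; apply: homog_hcoef;
    exact: ltn_trans i_s].
Qed.

Lemma gbd_coeff0 i (t : gcell i.+1) (t' : gcell i) : (gbd t t')@_0%MM = 0.
Proof.
have h e v : (@hcoef R s a c e v)@_0%MM = 0.
  by rewrite mcoeffB !mcoeffMn !prodX_coeff0 // !mul0rn subrr.
have v e w : (@vcoef R s b d e w)@_0%MM = 0.
  by rewrite mcoeffB !mcoeffMn !prodX_coeff0 // !mul0rn subrr.
case: i t t' => [|[|i]] /=; last by move=> *; rewrite mcoeff0.
- by case.
- by move=> q [e|f]; rewrite ?mcoeffN ?v ?h ?oppr0.
Qed.

Lemma cell_bounds P : (forall i j, P i j -> (j <= i <= s)%N) ->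
  forall i j, P i j -> (i <= s)%N && (j <= s)%N.
Proof. by move=> h i j /h /andP[ji si]; rewrite si (leq_trans ji). Qed.

Lemma sum_gbd0 (u : gcell 1 -> R) (v : gcell 0) : \sum_r u r * gbd r v =
  hbd a c (ext (fun e : cell s (hedge s) => u (inl e))) (val v).1 (val v).2 +
  vbd b d (ext (fun f : cell s (vedge s) => u (inr f))) (val v).1 (val v).2.
Proof. by rewrite big_sumType /= sum_hcoef sum_vcoef. Qed.

Lemma hbd_ext (x y : nat -> nat -> R) i j :
  (forall i j, x i j = y i j) -> hbd a c x i j = hbd a c y i j.
Proof. by move=> e; rewrite /hbd e; case: j => //= j; rewrite e. Qed.

Lemma vbd_ext (x y : nat -> nat -> R) i j :
  (forall i j, x i j = y i j) -> vbd b d x i j = vbd b d y i j.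
Proof. by move=> e; rewrite /vbd e; case: i => //= i; rewrite e. Qed.

Lemma hedge_bounds i j : hedge s i j -> (i <= s)%N && (j <= s)%N.
Proof. by move: i j; apply: cell_bounds => i j /andP[/ltnW -> ->]. Qed.

Lemma vedge_bounds i j : vedge s i j -> (i <= s)%N && (j <= s)%N.
Proof. by move: i j; apply: cell_bounds => i j /andP[-> /ltnW ->]. Qed.

Lemma square_bounds i j : square s i j -> (i <= s)%N && (j <= s)%N.
Proof. by move: i j; apply: cell_bounds => i j /andP[/ltnW -> /ltnW ->]. Qed.

Let dV2U1 : [disjoint V2 & U1]. Proof. by rewrite disjoint_sym. Qed.
Let dV2V1 : [disjoint V2 & V1]. Proof. by rewrite disjoint_sym. Qed.

Lemma exact0 (u : gcell 0 -> R) : \sum_t u t * ggen t = 0 <->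
  exists w : gcell 1 -> R, forall t, u t = \sum_r w r * gbd r t.
Proof.
rewrite /ggen (@ext_sum R s (vertex s) u (gen a b c d s)); split=> [u0|[w wE]].
  have [x [y [sx sy uE]]] := exact_vertices (prodX_neq0 K U1)
    (fun p q => prodX_coprime dU1V1) (prodX_neq0 K U2)
    (fun p q => prodX_coprime dU2V2) (divsetM V2)
    (fun p => divset_disjoint p dV2U1) (fun p => divset_disjoint p dV2V1)
    (ext_supported u) u0.
  exists (fun t : cell s (hedge s) + cell s (vedge s) => match t with
    | inl e => x (val e).1 (val e).2 | inr f => y (val f).1 (val f).2 end).
  move=> t; rewrite sum_gbd0 -ext_cell uE.
  congr (_ + _); [apply: hbd_ext|apply: vbd_ext] => i j;
    apply/esym/ext_eq => //.
    exact: hedge_bounds.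
  exact: vedge_bounds.
rewrite -[RHS](gen_relation a b c d
  (ext_supported (fun e : cell s (hedge s) => w (inl e)))
  (ext_supported (fun f : cell s (vedge s) => w (inr f)))).
apply: eq_bigr => i _; apply: eq_bigr => j _; congr (_ * _);
  move: (i : nat) (j : nat).
apply: ext_eq.
- exact: cell_bounds.
- by apply: bd_supported; apply: ext_supported.
by move=> t; rewrite wE sum_gbd0.
Qed.

Lemma exact1 (u : gcell 1 -> R) : (forall t, \sum_r u r * gbd r t = 0) <->
  exists w : gcell 2 -> R, forall t, u t = \sum_r w r * gbd r t.
Proof.
split=> [u0|[w wE] v].
  set x := ext (fun e : cell s (hedge s) => u (inl e)).
  set y := ext (fun f : cell s (vedge s) => u (inr f)).
  have xy0 i j : hbd a c x i j + vbd b d y i j = 0.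
    move: i j; apply: (@supported_eq0 R s (vertex s)).
    - exact: cell_bounds.
    - by apply: bd_supported; apply: ext_supported.
    by move=> t; rewrite -sum_gbd0 u0.
  have [w [sw xE yE]] := exact_edges (prodX_neq0 K U1)
    (fun p q => prodX_coprime dU1V1) (prodX_neq0 K V1) (prodX_neq0 K V2)
    (ext_supported _) (ext_supported _) xy0.
  exists (fun q : cell s (square s) => w (val q).1 (val q).2).
  case=> [e|f] /=.
    rewrite sum_vcoef -(ext_cell (fun e => u (inl e))) xE.
    by apply: vbd_ext => i j; apply/esym/ext_eq => //; exact: square_bounds.
  under eq_bigr => q _ do rewrite mulrN.
  rewrite sumrN sum_hcoef -(ext_cell (fun f => u (inr f))) yE; congr (- _).
  by apply: hbd_ext => i j; apply/esym/ext_eq => //; exact: square_bounds.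
have [sx sy] := square_bd_supported a b c d (ext_supported w).
rewrite sum_gbd0 -[RHS](bd_bd a b c d (ext w) (val v).1 (val v).2).
congr (_ + _); [apply: hbd_ext|apply: vbd_ext]; apply: ext_eq => //.
- exact: hedge_bounds.
- by move=> e; rewrite wE sum_vcoef.
- exact: vedge_bounds.
move=> f; rewrite wE /=; under eq_bigr => q _ do rewrite mulrN.
by rewrite sumrN sum_hcoef.
Qed.

(** There are no cells of dimension 3, so this is injectivity; it follows already from the component
    on vertical edges, minus [hbd], by [hbd_inj]. *)
Lemma exact2 (u : gcell 2 -> R) : (forall t, \sum_r u r * gbd r t = 0) <->
  exists w : gcell 3 -> R, forall t, u t = \sum_r w r * gbd r t.
Proof.
split=> [u0|[w wE] t]; last first.
  by rewrite big1 // => q _; rewrite wE big1 ?mul0r // => -[].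
exists (fun=> 0) => t; rewrite big1 => [|[]] //; rewrite -ext_cell.
apply: (@hbd_inj R a c (ext u) (prodX_neq0 K V1)) => i j.
have [_ sy] := square_bd_supported a b c d (ext_supported u).
apply/oppr_inj; rewrite oppr0; move: i j.
apply: (supported_eq0 vedge_bounds sy).
move=> f; have := u0 (inr f); rewrite /=; under eq_bigr => q _ do rewrite mulrN.
by rewrite sumrN sum_hcoef.
Qed.

Lemma exact_gbd i (u : gcell i.+1 -> R) :
  (forall t, \sum_r u r * gbd r t = 0) <->
  exists w : gcell i.+2 -> R, forall t, u t = \sum_r w r * gbd r t.
Proof.
case: i u => [|[|i]] u; [exact: exact1|exact: exact2|].
by split=> [_|_ t]; [exists (fun=> 0); case|rewrite big1 // => -[]].
Qed.

Variable J : R -> Prop.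
Hypothesis JE : forall p, J p <-> exists u : gcell 0 -> R,
  p = \sum_t u t * ggen t.

Definition ideal_complex : free_complex K N := cell_complex gdeg gbd.

Lemma ideal_complex_resolution :
  graded_resolution J (@zero_ideal K N) ideal_complex.
Proof.
apply: (@cell_complex_resolution _ _ _ _ _ _ _ ggen).
- exact: homog_ggen.
- exact: homog_gbd.
- move=> p; rewrite JE; split=> [[u ->]|[u [_ [-> ->]]]]; exists u.
    by exists 0; rewrite addr0.
  by rewrite addr0.
- exact: exact0.
- exact: exact_gbd.
Qed.

Lemma ideal_complex_minimal : minimal ideal_complex.
Proof. by move=> i k l; rewrite mxE gbd_coeff0. Qed.

(** The resolution of R / J is that of J moved up by one step, with R in position 0 and the
    generators as first differential. *)
Definition qcell i : finType := if i is i'.+1 then gcell i' else unit.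

Definition qdeg i : qcell i -> int :=
  if i is i'.+1 return qcell i -> int then @gdeg i' else fun=> 0.

Definition qbd i : qcell i.+1 -> qcell i -> R :=
  if i is i'.+1 return qcell i.+1 -> qcell i -> R then @gbd i' else fun t _ =>
    ggen t.

Definition quotient_complex : free_complex K N := cell_complex qdeg qbd.

Lemma quotient_complex_resolution :
  graded_resolution (@unit_ideal K N) J quotient_complex.
Proof.
apply: (@cell_complex_resolution _ _ _ _ _ _ _ (fun=> 1)).
- by move=> t; apply: homog1.
- case=> [|i] t t' /=; [rewrite subr0; exact: homog_ggen|exact: homog_gbd].
- move=> p; split=> // _; exists (fun=> p), 0; rewrite big_const card_unit /=.
  split; last by rewrite mulr1 !addr0.
  by apply/JE; exists (fun=> 0); rewrite big1 // => t _; rewrite mul0r.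
- move=> u; rewrite (big_pred1 tt) => [|[]] //; rewrite mulr1 JE.
  by split=> [[w wE]|[w wE]]; exists w => // -[].
case=> [|i] u; last exact: exact_gbd.
by rewrite -exact0; split=> [/(_ tt)|h []].
Qed.

Lemma quotient_complex_minimal (s_gt0 : (0 < s)%N) : minimal quotient_complex.
Proof.
case=> [|i] k l; rewrite mxE /=; last exact: gbd_coeff0.
(* At constant terms a generator becomes a power of 0 whose exponent is positive: s - j and j add up
   to s > 0. *)
rewrite /ggen /gen !rmorphM !rmorphXn /= !prodX_coeff0 // -!exprD.
set j := val _; have js : (j <= s)%N by rewrite -ltnS ltn_ord.
by rewrite subnK // exprD expr0n eqn0Ngt s_gt0 mul0r.
Qed.

Lemma quotient_complex_rank i : rank quotient_complex i =
  nth 0%N [:: 1; 'C(s + 2, 2); 2 * 'C(s + 1, 2); 'C(s, 2)]%N i.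
Proof.
case: i => [|[|[|[|i]]]] /=.
- exact: card_unit.
- exact: card_vertices.
- by rewrite card_sum card_hedges card_vedges mul2n addnn.
- exact: card_squares.
- by rewrite card_void nth_nil.
Qed.

End GridComplex.

(** * Powers of the cover ideal *)

Section IdealGen.

Variables (K : fieldType) (N : nat).
Local Notation R := {mpoly K[N]}.
Implicit Types (S : R -> Prop) (p q : R).

Lemma ideal_gen_incl S p : S p -> ideal_gen S p.
Proof.
by exists 1%N, (fun=> 1), (fun=> p); split=> //; rewrite big_ord1 mul1r.
Qed.

Lemma ideal_gen0 S : ideal_gen S 0.
Proof. by exists 0%N, (fun=> 0), (fun=> 0); split=> [[]|] //;
  rewrite big_ord0. Qed.

Lemma ideal_genD S p q : ideal_gen S p -> ideal_gen S q -> ideal_gen S (p + q).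
Proof.
move=> [k [c [g [Sg ->]]]] [l [e [h [Sh ->]]]].
pose glue (x : 'I_k -> R) (y : 'I_l -> R) i :=
  match split i with inl o => x o | inr o => y o end.
exists (k + l)%N, (glue c e), (glue g h); split=> [t|].
  by rewrite /glue; case: split.
rewrite big_split_ord; congr (_ + _); apply: eq_bigr => t _; rewrite /glue.
  by rewrite -[lshift l t]/(unsplit (inl t)) unsplitK.
by rewrite -[rshift k t]/(unsplit (inr t)) unsplitK.
Qed.

Lemma ideal_genM S p q : ideal_gen S q -> ideal_gen S (p * q).
Proof.
move=> [k [c [g [Sg ->]]]]; exists k, (fun t => p * c t), g; split=> //.
by rewrite mulr_sumr; apply: eq_bigr => t _; rewrite mulrA.
Qed.

Lemma ideal_gen_sum S (I : Type) (r : seq I) (P : pred I) (F : I -> R) :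
  (forall i, P i -> ideal_gen S (F i)) -> ideal_gen S (\sum_(i <- r | P i) F i).
Proof. by move=> h; apply: big_ind => //;
  [exact: ideal_gen0|exact: ideal_genD]. Qed.

Lemma ideal_gen_sub S S' p :
  (forall q, S q -> ideal_gen S' q) -> ideal_gen S p -> ideal_gen S' p.
Proof.
move=> h [k [c [g [Sg ->]]]]; apply: ideal_gen_sum => t _.
by apply/ideal_genM/h.
Qed.

Lemma ideal_gen_mul S S' S'' p q :
    (forall x y, S x -> S' y -> ideal_gen S'' (x * y)) ->
  ideal_gen S p -> ideal_gen S' q -> ideal_gen S'' (p * q).
Proof.
move=> h [k [c [g [Sg ->]]]] [l [e [f [Sf ->]]]].
rewrite mulr_suml; apply: ideal_gen_sum => t _.
rewrite mulr_sumr; apply: ideal_gen_sum => t' _.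
by rewrite mulrACA; apply/ideal_genM/h.
Qed.

End IdealGen.

Lemma gen_mul (R : idomainType) (a b c d : R) s s' i j i' j' :
    vertex s i j -> vertex s' i' j' ->
  gen a b c d s i j * gen a b c d s' i' j' =
  gen a b c d (s + s') (i + i') (j + j').
Proof.
move=> /andP[ji si] /andP[ji' si']; rewrite /gen.
have -> : (s + s' - (j + j') = (s - j) + (s' - j'))%N by lia.
have -> : (s + s' - (i + i') = (s - i) + (s' - i'))%N by lia.
by rewrite !exprD; ring.
Qed.

(** Splits a generator into j factors cd, then i - j factors ad, then s - i factors ab. *)
Lemma prod_gen (R : idomainType) (a b c d : R) s i j : vertex s i j ->
  gen a b c d s i j = \prod_(t < s) gen a b c d 1 (t < i)%N (t < j)%N.
Proof.
move=> /andP[ji si].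
suff h n : \prod_(t < n) gen a b c d 1 (t < i)%N (t < j)%N =
    gen a b c d n (minn i n) (minn j n).
  by rewrite h (minn_idPl si) (minn_idPl (leq_trans ji si)).
elim: n => [|n IH]; first by rewrite big_ord0 /gen !minn0 !mulr1.
rewrite big_ord_recr /= IH gen_mul ?addn1; [|rewrite /vertex; lia..].
by congr gen; lia.
Qed.

Section PowerIdeal.

Variables (K : fieldType) (N : nat) (a b c d : {mpoly K[N]}).
Local Notation R := {mpoly K[N]}.

Definition gens s (p : R) := exists i j, vertex s i j /\ p = gen a b c d s i j.

(** Multiplying generators adds their grid positions, and conversely [prod_gen] writes each vertex
    as a sum of s vertices of the staircase of size 1. *)
Lemma ideal_pow_gens (I : R -> Prop) s p :
  (forall q, I q <-> ideal_gen (gens 1) q) ->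
  ideal_pow I s p <-> ideal_gen (gens s) p.
Proof.
move=> hI; split; apply: ideal_gen_sub => q; last first.
  move=> [i [j [vij ->]]]; apply: ideal_gen_incl.
  exists (fun t : 'I_s => gen a b c d 1 (t < i)%N (t < j)%N).
  split=> [t|]; last exact: prod_gen.
  apply/hI/ideal_gen_incl; exists (t < i)%N, (t < j)%N; split=> //.
  by move: vij; rewrite /vertex; lia.
move=> [f [If ->]]; elim: s f If => [|s IH] f If.
  rewrite big_ord0; apply: ideal_gen_incl; exists 0%N, 0%N; split=> //.
  by rewrite /gen !mulr1.
rewrite big_ord_recr /=; have /hI := If ord_max.
apply: (ideal_gen_mul (S := gens s)); last exact: IH.
move=> _ _ [i [j [vij ->]]] [k [l [vkl ->]]]; apply: ideal_gen_incl.
rewrite gen_mul // addn1; exists (i + k)%N, (j + l)%N; split=> //.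
by move: vij vkl; rewrite /vertex; lia.
Qed.

Lemma span_gens s p : ideal_gen (gens s) p <->
  exists u : cell s (vertex s) -> R,
    p = \sum_t u t * gen a b c d s (val t).1 (val t).2.
Proof.
split=> [[k [e [g [gS ->]]]]|[u ->]]; last first.
  apply: ideal_gen_sum => t _; apply/ideal_genM/ideal_gen_incl.
  by exists (val t).1, (val t).2; split=> //; apply: valP t.
apply: (big_ind (fun p => exists u : cell s (vertex s) -> R,
  p = \sum_t u t * gen a b c d s (val t).1 (val t).2)) =>
    [|_ _ [u ->] [v ->]|t _].
- by exists (fun=> 0); rewrite big1 // => t _; rewrite mul0r.
- exists (fun t => u t + v t); rewrite -big_split.
  by apply: eq_bigr => t _; rewrite mulrDl.
have [i [j [vij ->]]] := gS t.
have [v [vi vj]] := cellP (cell_bounds (fun i j => id)) vij.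
exists (fun r => e t *+ (r == v)); rewrite (bigD1 v) //= eqxx vi vj.
by rewrite big1 ?addr0 // => r /negPf ->; rewrite mul0r.
Qed.

End PowerIdeal.

Section CoverIdeal.

Variables (K : fieldType) (N : nat) (U1 U2 V1 V2 : {set 'I_N}).
Hypotheses (dU1U2 : [disjoint U1 & U2]) (dU1V1 : [disjoint U1 & V1])
  (dU1V2 : [disjoint U1 & V2]) (dU2V2 : [disjoint U2 & V2])
  (dV1V2 : [disjoint V1 & V2]).

(** If w misses a vertex on each side, it misses the edge that joins them. *)
Lemma cover_bipartite (A B w : {set 'I_N}) : [disjoint A & B] ->
  (forall e, e \in complete_bipartite_edges A B -> w :&: e != set0) <->
  (A \subset w) || (B \subset w).
Proof.
move=> dAB; split=> [h|/orP h e /imset2P[u v uA]].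
  apply: contraT; rewrite negb_or => /andP[/subsetPn[u uA uw] /subsetPn[v vB
    vw]].
  have /h/set0Pn[x] : [set u; v] \in complete_bipartite_edges A B.
    apply: imset2_f => //; rewrite inE vB /=.
    by apply: contraTneq vB => <-; rewrite (disjointFr dAB).
  by rewrite !inE => /andP[xw /orP[]/eqP xE];
    rewrite xE ?(negPf uw) ?(negPf vw) in xw.
rewrite inE => /andP[vB _] ->{e}; apply/set0Pn.
by case: h => /subsetP h; [exists u|exists v]; rewrite !inE eqxx ?orbT ?andbT h.
Qed.

Let G := graph_union (complete_bipartite U1 (V1 :|: V2))
                     (complete_bipartite U2 V2).

Lemma vertex_coverE w : vertex_cover G w <->
  [/\ w \subset U1 :|: (V1 :|: V2) :|: (U2 :|: V2),
      (U1 \subset w) || (V1 :|: V2 \subset w) & (U2 \subset w) || (V2 \subset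
        w)].
Proof.
have dU1V : [disjoint U1 & V1 :|: V2].
  by rewrite -setI_eq0 setIUr !disjoint_setI0 ?setU0.
split=> [/andP[wV /forall_inP h]|[wV /(cover_bipartite _ dU1V) h1
  /(cover_bipartite _ dU2V2) h2]].
  split=> //; apply/cover_bipartite => // e eE; apply: h;
    rewrite inE eE ?orbT //.
by rewrite /vertex_cover wV; apply/forall_inP => e /setUP[/h1|/h2].
Qed.

(** The positions (0, 0), (1, 0), (1, 1) stand for the covers [U1 :|: U2], [U1 :|: V2], [V1 :|: V2].
    Every cover contains one of these, so its monomial is a multiple of a generator. *)
Lemma cover_ideal_gens (p : {mpoly K[N]}) : cover_ideal G p <->
  ideal_gen (gens (prodX K U1) (prodX K U2) (prodX K V1) (prodX K V2) 1) p.
Proof.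
have mult (A w : {set 'I_N}) i j : A \subset w -> vertex 1 i j ->
    prodX K A = gen (prodX K U1) (prodX K U2) (prodX K V1) (prodX K V2) 1 i j ->
    ideal_gen (gens (prodX K U1) (prodX K U2) (prodX K V1) (prodX K V2) 1)
      (prodX K w).
  move=> Aw vij AE.
  have dA : [disjoint w :\: A & A] by rewrite disjoints_subset setDE subsetIr.
  have -> : prodX K w = prodX K (w :\: A) * prodX K A.
    rewrite -(prodXU _ dA); congr (prodX K _); apply/setP => x; rewrite !inE.
    by case: (boolP (x \in A)) => [/(subsetP Aw) ->|]; rewrite ?orbF.
  by apply/ideal_genM/ideal_gen_incl; exists i, j.
have cov (A : {set 'I_N}) : vertex_cover G A -> cover_ideal G (prodX K A).
  by move=> cA; apply: ideal_gen_incl; exists A; rewrite prodXE.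
split; apply: ideal_gen_sub => q.
  move=> [w [/vertex_coverE[_ h1 h2] ->]]; rewrite prodXE.
  case/orP: h1 => [U1w|Vw]; last first.
    by apply: (mult _ _ 1%N 1%N Vw) => //; rewrite prodXU // /gen !mul1r.
  case/orP: h2 => h2.
    apply: (mult (U1 :|: U2) _ 0%N 0%N) => //; first by rewrite subUset U1w.
    by rewrite prodXU // /gen !mulr1.
  apply: (mult (U1 :|: V2) _ 1%N 0%N) => //; first by rewrite subUset U1w.
  by rewrite prodXU // /gen !mulr1 mul1r.
move=> [i [j [/andP[ji i1] ->]]].
case: i j i1 ji => [|[|//]] [|[|//]] // _ _;
  rewrite /gen !(mulr1, mul1r) -prodXU //; apply: cov; apply/vertex_coverE.
all: split; rewrite ?(subsetUl, subsetUr, subxx, orbT) //.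
all: by apply/subsetP => x; rewrite !inE => /orP[] ->; rewrite ?orbT.
Qed.

End CoverIdeal.

(** * Tor and regularity from a minimal resolution *)

Lemma minimal_homology (K : fieldType) (N : nat) (F : free_complex K N) i
    (k : 'I_(rank F i)) : minimal F -> homologyK_neq0 F i (shift k).
Proof.
move=> Fmin.
have dK0 r : diffK F r = 0 by apply/matrixP => x y; rewrite !mxE Fmin.
exists (delta_mx 0 k); split=> [l||[w /rowP /(_ k)]].
- by rewrite mxE; case: (l =P k) => [-> //|_]; rewrite andbF eqxx.
- by case: i k => // i k; rewrite /= dK0 mulmx0.
by rewrite dK0 mulmx0 !mxE !eqxx => /eqP; rewrite oner_eq0.
Qed.

(** The degrees of Tor are the shifts of F: [tor_shift] gives one inclusion, and by minimality every
    basis element of F gives a nonzero class. *)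
Lemma regularity_of_minimal (K : fieldType) (N : nat) (A : {mpoly K[N]} -> Prop)
    (F : free_complex K N) r :
    graded_resolution A (@zero_ideal K N) F -> minimal F ->
  is_regularity A (@zero_ideal K N) r <->
  is_max (fun t => exists i (k : 'I_(rank F i)), t = shift k - i%:Z) r.
Proof.
move=> resF Fmin.
have E t : (exists i j, tor_neq0 A (@zero_ideal K N) i j /\ t = j - i%:Z) <->
    (exists i (k : 'I_(rank F i)), t = shift k - i%:Z).
  split=> [[i [j [[H resH Hij] ->]]]|[i [k ->]]].
    by have [k <-] := tor_shift resF resH Hij; exists i, k.
  exists i, (shift k); split=> //; exists F => //; exact: minimal_homology.
by split=> -[/E Pr max_r]; split=> // t /E; apply: max_r.
Qed.

Lemma seq_has_max (l : seq int) x : x \in l ->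
  exists2 r, r \in l & forall y, y \in l -> y <= r.
Proof.
elim: l x => // z l IH x _; case: l IH =>
  [_|y l /(_ y (mem_head _ _))[r rl rmax]].
  by exists z; rewrite ?mem_head // => y; rewrite inE => /eqP ->.
case: (leP z r) => zr.
  exists r; first by rewrite inE rl orbT.
  by move=> t; rewrite inE => /orP[/eqP ->|/rmax].
exists z; rewrite ?mem_head // => t; rewrite inE => /orP[/eqP ->|/rmax] //.
by move=> /le_trans; apply; apply: ltW.
Qed.

Definition cell_regularity (n1 n2 m1 m2 s : nat) (t : int) := exists i j : nat,
  [\/ (j <= i <= s)%N /\
      t = ((s - j) * n1 + (s - i) * n2 + j * m1 + i * m2)%N%:Z,
      (j < i <= s)%N /\
      t = ((s - j) * n1 + (s - i) * n2 + (j + 1) * m1 + i * m2)%N%:Z - 1,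
      (j < i <= s)%N /\
      t = ((s - j) * n1 + (s - i + 1) * n2 + j * m1 + i * m2)%N%:Z - 1 |
      (j < i < s)%N /\
      t = ((s - j) * n1 + (s - i) * n2 + (j + 1) * m1 + (i + 1) * m2)%N%:Z - 2].

Section GridDegrees.

Variables (N : nat) (U1 U2 V1 V2 : {set 'I_N}) (s : nat).
Local Notation regularity_at := (cell_regularity #|U1| #|U2| #|V1| #|V2| s).

(** The four families come from vertices, horizontal edges, vertical edges and squares. The third
    names a vertical edge by its end with the larger i, the complex by the other end, whence a shift
    of i by one. *)
Lemma cell_regularityP t :
  (exists i (x : gcell s i), t = gdeg U1 U2 V1 V2 x - i%:Z) <-> regularity_at t.
Proof.
split=> [[[|[|[|i]]] [x ->]] //|[i [j []]] [P ->]].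
- exists (val x).1, (val x).2; constructor 1; split; first exact: (valP x).
  by rewrite /= /grid_degree !addn0 subr0.
- case: x => x.
    exists (val x).1, (val x).2; constructor 2; split; first exact: (valP x).
    by rewrite /= /grid_degree addn0.
  have /andP[ji js] := valP x.
  exists (val x).1.+1, (val x).2; constructor 3; split;
    first by rewrite ltnS ji.
  by rewrite /= /grid_degree addn0 addn1 [(_ - _ + 1)%N]addn1 -subSn.
- by exists (val x).1, (val x).2; constructor 4; split=> //; exact: (valP x).
- have [x [xi xj]] := cellP (@cell_bounds s (vertex s) (fun _ _ => id)) P.
  by exists 0%N, x; rewrite /= /grid_degree xi xj subr0 !addn0.
- have [x [xi xj]] := cellP (@hedge_bounds s) P.
  by exists 1%N, (inl x); rewrite /= /grid_degree xi xj addn0.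
- case: i P => // i P; have [x [xi xj]] := cellP (@vedge_bounds s) P.
  exists 1%N, (inr x); rewrite /= /grid_degree xi xj addn0 !addn1 -subSn //.
  by case/andP: P.
have [x [xi xj]] := cellP (@square_bounds s) P.
by exists 2%N, x; rewrite /= /grid_degree xi xj.
Qed.

Lemma shift_regularityP (K : fieldType) t :
  (exists i (k : 'I_(rank (ideal_complex K U1 U2 V1 V2 s) i)),
     t = shift k - i%:Z) <-> regularity_at t.
Proof.
rewrite -cell_regularityP; split=> -[i [x ->]]; exists i.
  by exists (enum_val x).
by exists (enum_rank x); rewrite /= enum_rankK.
Qed.

Lemma cell_regularity_max : exists r, is_max regularity_at r.
Proof.
pose vals i := [seq gdeg U1 U2 V1 V2 x - i%:Z | x : gcell s i].
have valsP t : t \in vals 0%N ++ vals 1%N ++ vals 2%N <-> regularity_at t.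
  rewrite -cell_regularityP !mem_cat; split.
    by case/or3P => /imageP[x _ ->]; [exists 0%N, x|exists 1%N, x|exists 2%N,
      x].
  by case=> -[|[|[|i]]] [x ->] //; apply/or3P;
    [constructor 1|constructor 2|constructor 3]; apply: image_f.
(* The vertex (0, 0) shows that the finite set of values is nonempty. *)
have /valsP/seq_has_max[r /valsP hr rmax] :
    regularity_at (s * #|U1| + s * #|U2|)%N.
  by exists 0%N, 0%N; constructor 1; rewrite subn0 !mul0n !addn0.
by exists r; split=> // t /valsP; apply: rmax.
Qed.

End GridDegrees.

Theorem theorem3p6 (K : fieldType) (n m n1 n2 m1 m2 s : nat)
    (hn : n = (n1 + n2)%N) (hm : m = (m1 + m2)%N)
    (hn1 : (1 <= n1)%N) (hn2 : (1 <= n2)%N)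
    (hm1 : (1 <= m1)%N) (hm2 : (1 <= m2)%N) (hs : (1 <= s)%N) :
  let U  : {set 'I_(n + m)} := [set lshift m i | i : 'I_n] in
  let U1 : {set 'I_(n + m)} := [set lshift m i | i : 'I_n & (i < n1)%N] in
  let U2 : {set 'I_(n + m)} := U :\: U1 in
  let V  : {set 'I_(n + m)} := [set rshift n i | i : 'I_m] in
  let V1 : {set 'I_(n + m)} := [set rshift n i | i : 'I_m & (i < m1)%N] in
  let V2 : {set 'I_(n + m)} := V :\: V1 in
  let G := graph_union (complete_bipartite U1 V) (complete_bipartite U2 V2) in
  let Js : {mpoly K[n + m]} -> Prop := ideal_pow (cover_ideal (K := K) G) s in
  (exists F : free_complex K (n + m),
    [/\ graded_resolution (@unit_ideal K (n + m)) Js F,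
        minimal F &
        forall i, rank F i =
          nth 0%N [:: 1; 'C(s + 2, 2); 2 * 'C(s + 1, 2); 'C(s, 2)]%N i]) /\
  (exists r : int,
    is_regularity Js (@zero_ideal K (n + m)) r /\
    is_max (fun t : int => exists i j : nat,
      [\/ (j <= i <= s)%N /\
          t = ((s - j) * n1 + (s - i) * n2 + j * m1 + i * m2)%N%:Z,
          (j < i <= s)%N /\
          t = ((s - j) * n1 + (s - i) * n2 + (j + 1) * m1 + i * m2)%N%:Z - 1,
          (j < i <= s)%N /\
          t = ((s - j) * n1 + (s - i + 1) * n2 + j * m1 + i * m2)%N%:Z - 1 |
          (j < i < s)%N /\
          t = ((s - j) * n1 + (s - i) * n2 + (j + 1) * m1
               + (i + 1) * m2)%N%:Z - 2]) r).
Proof.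
move=> U U1 U2 V V1 V2 G Js.
have card_low p q (f : 'I_p -> 'I_(n + m)) : injective f -> (q <= p)%N ->
    #|[set f i | i : 'I_p & (i < q)%N]| = q.
  move=> f_inj qp; rewrite card_imset // -sum1_card big_mkcond /=.
  rewrite -[RHS](sum_ltn qp); apply: eq_bigr => i _.
  by rewrite inE; case: ltnP.
have subU : U1 \subset U by apply: imsetS; apply/subsetP.
have subV : V1 \subset V by apply: imsetS; apply/subsetP.
have dUV : [disjoint U & V].
  rewrite -setI_eq0; apply/eqP/setP => x; rewrite !inE.
  by apply/andP => -[/imsetP[i _ ->] /imsetP[j _ /eqP]]; rewrite eq_lrshift.
have cU1 : #|U1| = n1 by apply: card_low; [exact: lshift_inj|lia].
have cV1 : #|V1| = m1 by apply: card_low; [exact: rshift_inj|lia].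
have cU2 : #|U2| = n2.
  rewrite cardsD (setIidPr subU) cU1 card_imset; last exact: lshift_inj.
  by rewrite card_ord; lia.
have cV2 : #|V2| = m2.
  rewrite cardsD (setIidPr subV) cV1 card_imset; last exact: rshift_inj.
  by rewrite card_ord; lia.
have dsub (A B : {set 'I_(n + m)}) : A \subset U -> B \subset V -> [disjoint A
  & B].
  by move=> AU BV; apply: disjointWl AU (disjointWr BV dUV).
have subU2 : U2 \subset U by apply: subsetDl.
have subV2 : V2 \subset V by apply: subsetDl.
have dD (A B : {set 'I_(n + m)}) : [disjoint A & B :\: A].
  by rewrite disjoint_sym disjoints_subset setDE subsetIr.
have dU12 : [disjoint U1 & U2] by apply: dD.
have dV12 : [disjoint V1 & V2] by apply: dD.
have VE : V = V1 :|: V2 by rewrite -{1}(setID V V1) (setIidPr subV).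
(* The link between the ideal and the staircase: both resolutions below take it as their description
   of [Js]. *)
have JsE p : Js p <-> exists u : gcell s 0 -> {mpoly K[n + m]},
    p = \sum_t u t * ggen K U1 U2 V1 V2 t.
  rewrite -[X in _ <-> X]span_gens; apply: ideal_pow_gens => q.
  by rewrite /G VE; apply: cover_ideal_gens => //; apply: dsub.
have nz (A : {set 'I_(n + m)}) k : #|A| = k -> (1 <= k)%N -> A != set0.
  by move=> <-; rewrite card_gt0.
have U1nz := nz _ _ cU1 hn1; have U2nz := nz _ _ cU2 hn2.
have V1nz := nz _ _ cV1 hm1; have V2nz := nz _ _ cV2 hm2.
split.
  exists (quotient_complex K U1 U2 V1 V2 s); split.
  - by apply: quotient_complex_resolution => //; apply: dsub.
  - exact: quotient_complex_minimal.
  exact: quotient_complex_rank.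
have [r r_max] := cell_regularity_max U1 U2 V1 V2 s.
exists r; split; last by rewrite cU1 cU2 cV1 cV2 in r_max.
apply/(regularity_of_minimal (F := ideal_complex K U1 U2 V1 V2 s)).
- by apply: ideal_complex_resolution => //; apply: dsub.
- exact: ideal_complex_minimal.
case: r_max => hr rmax; split=> [|t]; rewrite shift_regularityP //; exact: rmax.
Qed.
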